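(* Let $k\ge 1$ be a fixed integer and let $\varepsilon>0$. For a positive integer $w$ put $n=k\cdot w$ and $\lambda=(w,w,\ldots,w)=(w^k)\in H(k,0;n)$. Then for all sufficiently large $w$ (depending on $k$ and $\varepsilon$) there exists a partition $\nu\vdash n$ such that $$\kappa(\lambda,\lambda,\nu)\ge n^{(k^2-4)(k^2-1)/4-\varepsilon}.$$
   Context: For a partition $\lambda\vdash n$, $\chi^\lambda$ denotes the corresponding irreducible (characteristic zero) character of the symmetric group $S_n$. For two characters $\varphi,\psi$ of $S_n$, the Kronecker product is $(\varphi\otimes\psi)(\sigma)=\varphi(\sigma)\psi(\sigma)$. For $\lambda,\mu\vdash n$, the Kronecker multiplicities $\kappa(\lambda,\mu,\nu)$ are defined by $\chi^\lambda\otimes\chi^\mu=\sum_{\nu\vdash n}\kappa(\lambda,\mu,\nu)\chi^\nu$. $H(k,0;n)$ is the set of partitions of $n$ with at most $k$ nonzero parts; $(w^k)$ is the partition with $k$ parts all equal to $w$. *)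

(* Defs.v *)
From HB Require Import structures.
From mathcomp Require Import all_boot all_order all_algebra all_fingroup.
From mathcomp Require Import all_solvable all_field all_character.

Set Implicit Arguments.
Unset Strict Implicit.
Unset Printing Implicit Defensive.

Import Order.TTheory GRing.Theory Num.Theory.
Local Open Scope ring_scope.

(* Partitions are weakly decreasing sequences of nonzero parts (no padding). *)
Definition is_partition (n : nat) (l : seq nat) : bool :=
  [&& sorted geq l, 0%N \notin l & sumn l == n].

Record intpart (n : nat) := IntPart {
  parts :> seq nat;
  parts_partition : is_partition n parts }.

HB.instance Definition _ n := [isSub for @parts n].
HB.instance Definition _ n := [Countable of intpart n by <:].

Lemma size_intpart n (p : intpart n) : (size p <= n)%N.
Proof.
case: p => l /= /and3P[_ + /eqP <-]; elim: l => //= a l IHl.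
rewrite inE negb_or => /andP[a0 /IHl sl].
by rewrite -add1n leq_add // lt0n eq_sym.
Qed.

Lemma leq_intpart n (p : intpart n) a : a \in (p : seq nat) -> (a <= n)%N.
Proof.
case: p => l /= /and3P[_ _ /eqP <-]; elim: l => //= b l IHl.
rewrite inE => /predU1P[-> | /IHl la]; first exact: leq_addr.
exact: leq_trans la (leq_addl _ _).
Qed.

Definition intpart_encode n (p : intpart n) : n.-bseq 'I_n.+1 :=
  insub_bseq n (map (@inord n) p).
Definition intpart_decode n (b : n.-bseq 'I_n.+1) : option (intpart n) :=
  insub (map val b).

Lemma intpart_encodeK n : pcancel (@intpart_encode n) (@intpart_decode n).
Proof.
move=> p; rewrite /intpart_decode /intpart_encode /insub_bseq.
rewrite insubdK ?unfold_in /= ?size_map ?size_intpart //.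
rewrite -map_comp (_ : map _ _ = val p) ?valK //.
rewrite -[RHS]map_id; apply/eq_in_map => a ap /=.
by rewrite inordK // ltnS (leq_intpart ap).
Qed.

HB.instance Definition _ n : isFinite (intpart n) :=
  PCanIsFinite (@intpart_encodeK n).

Lemma rect_is_partition k w :
  (0 < w)%N -> is_partition (k * w) (nseq k w).
Proof.
move=> w_gt0; apply/and3P; split; last by rewrite sumn_nseq mulnC.
  by case: k => //= k; elim: k => //= k ->; rewrite /= andbT /geq /=.
by rewrite mem_nseq negb_and orbC neq_ltn w_gt0.
Qed.

Definition rect_intpart k w (w_gt0 : (0 < w)%N) : intpart (k * w) :=
  IntPart (rect_is_partition k w_gt0).

Section Specht.
Variables (n : nat) (p : intpart n).

(* The standard tableau of shape p obtained by writing 0, ..., n - 1 row by   *)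
(* row: the entry i lies in row [reshape_index p i] and column                *)
(* [reshape_offset p i].                                                      *)
Definition row_stabilizer : {set 'S_n} :=
  [set s : 'S_n | [forall i, reshape_index p (s i) == reshape_index p i]].
Definition column_stabilizer : {set 'S_n} :=
  [set s : 'S_n | [forall i, reshape_offset p (s i) == reshape_offset p i]].

Local Notation rG := (regular_repr algC [set: 'S_n]%G).

(* The Young symmetrizer \sum_(s in R) \sum_(t in C) sgn(t) s t, as a vector  *)
(* of the regular module: [gring_row (rG g)] is the basis vector of g.        *)
Definition young_symmetrizer : 'rV[algC]_(#|[set: 'S_n]|) :=
  \sum_(s in row_stabilizer) \sum_(t in column_stabilizer)
    (-1) ^+ (odd_perm t) *: gring_row (rG (s * t)%g).

(* The character of the Specht module, i.e. of the submodule of the regular   *)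
(* module generated by the Young symmetrizer. MathComp representations act on *)
(* row vectors from the right, so this is a right ideal of the group algebra. *)
Definition specht_char : 'CF([set: 'S_n]) :=
  cfRepr (submod_repr (cyclic_mx_module rG young_symmetrizer)).

End Specht.

(* The coefficient of the character of nu in the expansion of the product of  *)
(* the characters of la and mu over the family of the characters of all       *)
(* partitions of n, which is a basis of the class functions. This coefficient *)
(* is a natural number in algC; [Num.truncn] only moves it to nat.            *)
Definition kronecker_mult n (la mu nu : intpart n) : nat :=
  Num.truncn
    (coord [tuple specht_char (enum_val i) | i < #|{: intpart n}|]
       (enum_rank nu) (specht_char la * specht_char mu)).

(* Main.v *)
Require Import Defs.
From mathcomp Require Import all_boot all_order all_algebra all_fingroup.
From mathcomp Require Import all_solvable all_field all_character.
From mathcomp Require Import reals exp.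
From mathcomp Require Import zify ring.

Set Implicit Arguments.
Unset Strict Implicit.
Unset Printing Implicit Defensive.

Import Order.TTheory GRing.Theory Num.Theory.
Local Open Scope ring_scope.

(** Let [N(nu)] be the degree of the Specht character of [nu]. Every constituent
    [nu] of the square of the character of [la = (w^k)] has at most [K = k^2]
    rows, so comparing degrees gives
    [N(la)^2 <= max_nu kappa(la,la,nu) * sum_(size nu <= K) N(nu)].
    With [l_i = nu_i + K - i] and [P = K(K-1)/2], the degree formula reads
    [N(nu) = (n!/(n+P)!) * multinomial(n+P; l) * V(l)] with [V] the Vandermonde
    determinant.  As [V] is discrete harmonic, the sum of [V^2] over the contents
    of the words of length [n+P] in [K] letters is [O(K^n n^P)], and hence the
    sum of [N(nu)] is [O(K^n n^(-P/2))]. On the other side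
    [N(la)^2 >= c k^(2n) n^(-(k^2-1))], and
    [P/2 - (k^2-1) = (k^2-4)(k^2-1)/4].

    That the Specht characters are all the irreducible characters follows without
    classifying conjugacy classes: they are irreducible and distinct, their
    degrees are at least the numbers of standard tableaux, and the squares of
    these numbers add up to [n!]. *)

(** * Ballot words and numbers of standard tableaux *)

Local Open Scope nat_scope.

(** The sum of degrees is bounded without asymptotics of single shapes. For every s > 0 one has V <=
    V^2/s + s, which trades the sum of V for its second moment; s = n^(P/2), the order of the root
    mean square of V over the words of length n + P, balances both terms. The second moment is known
    exactly: adding and deleting a letter are adjoint operations for the multinomial weight, and V
    is an eigenvector of both in each degree, so the moments satisfy a one-term recursion in the
    length. The powers k^(2n) and K^n cancel exactly, since K = k^2; only powers of n and a constant
    depending on k survive, and n^eps absorbs that constant. The bound K on the number of rows is a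
    pigeonhole argument: the first column of nu may not have more cells than there are pairs of a
    row of la and a row of mu. Half-integral exponents are avoided until the end by squaring, or by
    an abstract s with s^2 = n^P, so the estimates hold over any real field. *)

Definition add_box (f : nat -> nat) (i x : nat) : nat := f x + (x == i).
Definition del_box (f : nat -> nat) (i x : nat) : nat := f x - (x == i).

Section Ballot.
Variable K : nat.
Implicit Types (f g : nat -> nat) (w : seq nat).

Definition decreasing f := all (fun i => f i.+1 <= f i) (iota 0 K.-1).

Definition content w : nat -> nat := fun i => count_mem i w.

Definition eq_shape f g := all (fun i => f i == g i) (iota 0 K).

(** Lattice (Yamanouchi) words: each letter is the row that receives the next box, so that a word of
    content [f] is a standard tableau of shape [f]. *)
Fixpoint ballot_words n : seq (seq nat) :=
  if n is m.+1 then
    [seq rcons w i | w <- ballot_words m,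
                     i <- [seq i <- iota 0 K | decreasing (content (rcons w i))]]
  else [:: [::]].

Definition ballot_number n f := count (fun w => eq_shape (content w) f) (ballot_words n).

Lemma decreasingP f : reflect (forall i, i.+1 < K -> f i.+1 <= f i) (decreasing f).
Proof.
apply: (iffP allP) => fP i iK; apply: fP; move: iK; rewrite mem_iota; lia.
Qed.

Lemma eq_shapeP f g : reflect (forall i, i < K -> f i = g i) (eq_shape f g).
Proof.
apply: (iffP allP) => [fP i iK|fP i]; first by apply/eqP/fP; rewrite mem_iota.
by rewrite mem_iota => /fP ->.
Qed.

Lemma eq_decreasing f g : (forall i, i < K -> f i = g i) -> decreasing f = decreasing g.
Proof.
move=> fg; apply/decreasingP/decreasingP => fP i iK; have := fP i iK;
  by rewrite !fg // ltnW.
Qed.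

Lemma decreasing_le f i j : decreasing f -> i <= j -> j < K -> f j <= f i.
Proof.
move=> /decreasingP dec_f; elim: j => [|j IHj]; first by rewrite leqn0 => /eqP->.
rewrite leq_eqVlt ltnS => /predU1P[->//|ij] jK.
exact: leq_trans (dec_f _ jK) (IHj ij (ltnW jK)).
Qed.

Lemma eq_eq_shape g f f' : (forall i, i < K -> f i = f' i) -> eq_shape g f = eq_shape g f'.
Proof.
by move=> ff'; apply/eq_shapeP/eq_shapeP => fP i iK; rewrite fP // ff'.
Qed.

Lemma eq_ballot_number n f g :
  (forall i, i < K -> f i = g i) -> ballot_number n f = ballot_number n g.
Proof. by move=> fg; apply: eq_count => w; apply: eq_eq_shape. Qed.

Lemma content_rcons w i : content (rcons w i) =1 add_box (content w) i.
Proof. by move=> x; rewrite /content -cats1 count_cat /= addn0 eq_sym. Qed.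

Lemma ballot_number0 f : ballot_number 0 f = eq_shape (fun=> 0) f.
Proof. by rewrite /ballot_number /= addn0. Qed.

Lemma sum_ballot_wordsS (F : seq nat -> nat) n :
  \sum_(w <- ballot_words n.+1) F w =
  \sum_(w <- ballot_words n) \sum_(i < K | decreasing (content (rcons w i))) F (rcons w i).
Proof.
rewrite /= big_allpairs_dep; apply: eq_bigr => w _.
by rewrite big_filter /= -[K in iota 0 K]subn0 -/(index_iota 0 K) big_mkord.
Qed.

(** Cut off the last letter. A row whose shortening leaves no partition contributes 0, so the sum
    may run over all nonempty rows. *)
Lemma ballot_numberS n f : decreasing f ->
  ballot_number n.+1 f = \sum_(i < K | 0 < f i) ballot_number n (del_box f i).
Proof.
move=> dec_f; rewrite /ballot_number -[LHS]sum1_count big_mkcond sum_ballot_wordsS.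
under [RHS]eq_bigr do rewrite -sum1_count big_mkcond.
rewrite exchange_big /=; apply: eq_bigr => w _.
rewrite !big_mkcond [RHS]big_mkcond; apply: eq_bigr => i _.
have -> : eq_shape (content (rcons w i)) f = (0 < f i) && eq_shape (content w) (del_box f i).
  apply/eq_shapeP/andP => [wf|[f0 /eq_shapeP wf] x xK].
    split; first by rewrite -wf // content_rcons /add_box eqxx addn1.
    by apply/eq_shapeP => x xK; rewrite /del_box -wf // content_rcons /add_box addnK.
  rewrite content_rcons /add_box wf // /del_box; case: eqP => [->|]; lia.
case f0: (0 < f i); last by case: ifP.
case: ifP => [_|/negP ndec] //=; case: ifP => // /eq_shapeP wf; case: ndec.
rewrite (@eq_decreasing _ f) // => x xK.
by rewrite content_rcons /add_box wf // /del_box; case: eqP => [->|]; lia.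
Qed.

Lemma ballot_number_not_decreasing n f : ~~ decreasing f -> ballot_number n f = 0.
Proof.
move=> ndec; apply/eqP; rewrite -leqn0 leqNgt -has_count; apply/hasPn => w.
move=> w_ballot; apply: contra ndec => /eq_shapeP wf.
rewrite -(@eq_decreasing (content w)) //.
case: n w_ballot => [|n] /=; first by rewrite inE => /eqP -> ; apply/decreasingP.
case/allpairsPdep => v [i [_ + ->]].
by rewrite mem_filter => /andP[].
Qed.

Lemma ballot_number_not_empty i f : i < K -> 0 < f i -> ballot_number 0 f = 0.
Proof.
move=> iK f0; rewrite ballot_number0; apply/eqP; rewrite eqb0.
by apply/eq_shapeP => /(_ i iK) fi; rewrite -fi in f0.
Qed.

End Ballot.

(** Removing a box never makes room for one in another row, and adding one never frees a box of
    another row; hence if the swap gives a partition, each half does. *)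
Lemma decreasing_swap K f i j : i != j -> 0 < f j -> decreasing K f ->
  decreasing K (add_box (del_box f j) i) ->
  decreasing K (add_box f i) && decreasing K (del_box f j).
Proof.
move=> ij fj /decreasingP dec_f /decreasingP dec_g.
apply/andP; split; apply/decreasingP => x xK; have := dec_g x xK; have := dec_f x xK;
  rewrite /add_box /del_box; case: (eqVneq x i); case: (eqVneq x j);
  case: (eqVneq x.+1 i); case: (eqVneq x.+1 j) => *; subst; try lia;
  by rewrite eqxx in ij.
Qed.

(** Row j + 1 accepts a box exactly when row j can lose one, and row 0 always accepts one, whence
    the successor. The last row is empty, so it has nothing to lose. *)
Lemma card_addable k f : decreasing k.+1 f -> f k = 0 ->
  \sum_(i < k.+1) (decreasing k.+1 (add_box f i) : nat) =
  (\sum_(j < k.+1 | 0 < f j) (decreasing k.+1 (del_box f j) : nat)).+1.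
Proof.
move=> /decreasingP dec_f fk; rewrite big_ord_recl [X in _ = X.+1]big_mkcond.
rewrite [X in _ = X.+1]big_ord_recr /= fk addn0.
have -> : decreasing k.+1 (add_box f 0).
  apply/decreasingP => x xk; have := dec_f x xk; rewrite /add_box; lia.
rewrite add1n; congr _.+1; apply: eq_bigr => j _; have jk := ltn_ord j.
have -> : decreasing k.+1 (add_box f (bump 0 j)) = (f j.+1 < f j).
  apply/decreasingP/idP => [/(_ j jk)|fj x xk].
    by rewrite /add_box /bump; lia.
  have := dec_f x xk; rewrite /add_box /bump; case: (eqVneq x j) => [->|]; lia.
case: ifP => f0; last by apply/eqP; rewrite eqb0; lia.
congr nat_of_bool; apply/idP/decreasingP => [fj x xk|/(_ j jk)].
  have := dec_f x xk; rewrite /del_box; case: (eqVneq x j) => [->|]; lia.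
by rewrite /del_box; lia.
Qed.

(* The up and down operators U, D of Young's lattice satisfy DU - UD = 1, and *)
(* the ballot numbers are the coordinates of U^n applied to the empty shape.  *)
Lemma ballot_number_up k n f : decreasing k.+1 f -> f k = 0 ->
  \sum_(i < k.+1) ballot_number k.+1 n.+1 (add_box f i) = n.+1 * ballot_number k.+1 n f.
Proof.
pose N := ballot_number k.+1; pose D := decreasing k.+1.
have swap m h i j : D h -> i != j -> 0 < h j ->
    (if D (add_box h i) then N m (del_box (add_box h i) j) else 0) =
    (if D (del_box h j) then N m (add_box (del_box h j) i) else 0).
  move=> dec_h ij hj; have -> : N m (del_box (add_box h i) j) = N m (add_box (del_box h j) i).
    apply: eq_ballot_number => x _; rewrite /add_box /del_box.
    by case: (eqVneq x i) => [->|_]; case: (eqVneq _ j) => [e|_]; subst; lia.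
  case dec_g : (D (add_box (del_box h j) i)).
    by have /andP[] := decreasing_swap ij hj dec_h dec_g; rewrite -/D => -> ->.
  by rewrite /N (ballot_number_not_decreasing _ (negbT dec_g)) !if_same.
(* Of the removals after adding a box in row i, the one in row i gives [h] back; the others commute
   past the addition by [swap]. *)
have expand m h (i : 'I_k.+1) : D h -> N m.+1 (add_box h i) = D (add_box h i) * N m h +
    \sum_(j < k.+1 | (0 < h j) && (j != i))
      (if D (del_box h j) then N m (add_box (del_box h j) i) else 0).
  move=> dec_h; under [X in _ = _ + X]eq_bigr => j /andP[hj ji].
    rewrite -swap //; last by rewrite eq_sym.
    over.
  case dec_hi : (D (add_box h i)); last first.
    by rewrite big1 // /N (ballot_number_not_decreasing _ (negbT dec_hi)).
  rewrite /N ballot_numberS // (bigD1 i) /=; last by rewrite /add_box eqxx addn1.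
  rewrite mul1n; congr (_ + _).
    by apply: eq_ballot_number => x _; rewrite /add_box /del_box addnK.
  apply: eq_bigl => j; apply: andb_id2r => ji.
  by rewrite /add_box (inj_eq val_inj) (negPf ji) addn0.
elim: n f => [|n IHn] f dec_f fk; rewrite (eq_bigr _ (fun i _ => expand _ _ i dec_f)).
  rewrite big_split /= -big_distrl /= card_addable // mulSn mul1n [X in _ + X = _]big1.
    rewrite addn0 -[RHS]addn0; congr (_ + _).
    case: (posnP (N 0 f)) => [->|]; first by rewrite muln0.
    rewrite /N ballot_number0 lt0b => /eq_shapeP f0.
    by rewrite big1 // => j; rewrite -f0.
  move=> i _; rewrite big1 // => j /andP[fj ji]; case: ifP => // _.
  apply: (@ballot_number_not_empty _ i) => //.
  by rewrite /add_box eqxx addn1.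
rewrite big_split /= -big_distrl /= card_addable // mulSn.
set rem := \sum_(j < k.+1 | 0 < f j) _.
pose S := \sum_(i < k.+1) \sum_(j < k.+1 | (0 < f j) && (j != i))
      (if D (del_box f j) then N n.+1 (add_box (del_box f j) i) else 0).
(* [S] is the off-diagonal part of UD applied at [f], and [rem] supplies its diagonal: each
   removable box, put back, returns [f]. The induction hypothesis then applies to [f] with a box
   removed. *)
suff : S + rem * N n.+1 f = n.+1 * N n.+1 f.
  by rewrite -/N -/S => eS; rewrite (mulSn n.+1) -eS; lia.
have -> : S = \sum_(j < k.+1 | 0 < f j) \sum_(i < k.+1 | i != j)
      (if D (del_box f j) then N n.+1 (add_box (del_box f j) i) else 0).
  rewrite /S (exchange_big_dep (fun j : 'I_k.+1 => 0 < f j)) /=; last by move=> i j _ /andP[].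
  by apply: eq_bigr => j fj; apply: eq_bigl => i; rewrite fj /= (eq_sym i).
rewrite /rem big_distrl -big_split /N (ballot_numberS _ dec_f) big_distrr /=.
apply: eq_bigr => j fj; rewrite -/(D _); case dec_fj : (D (del_box f j)); last first.
  by rewrite big1 // (ballot_number_not_decreasing _ (negbT dec_fj)) muln0.
have del_k : del_box f j k = 0 by rewrite /del_box fk.
rewrite mul1n -(IHn _ dec_fj del_k) [RHS](bigD1 j) //= addnC; congr (_ + _).
rewrite -(ballot_numberS _ dec_f); apply: eq_ballot_number => x _.
by rewrite /add_box /del_box; case: (eqVneq x j) => [->|]; lia.
Qed.

Lemma size_ballot_word K n w : w \in ballot_words K n -> size w = n.
Proof.
elim: n w => [|n IHn] w /=; first by rewrite inE => /eqP->.
by case/allpairsPdep => v [i [/IHn vn _ ->]]; rewrite size_rcons vn.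
Qed.

Lemma ballot_word_decreasing K n w m : w \in ballot_words K n ->
  decreasing K (content (take m w)).
Proof.
elim: n w => [|n IHn] w /=; first by rewrite inE => /eqP->; apply/decreasingP.
case/allpairsPdep => v [i [v_ballot + ->]]; rewrite mem_filter => /andP[dec_w _].
have [mv|mv] := leqP m (size v); last by rewrite take_oversize // size_rcons.
by rewrite -cats1 takel_cat // IHn.
Qed.

Lemma ballot_word_letters K n w i : w \in ballot_words K n -> i \in w -> i < K.
Proof.
elim: n w => [|n IHn] w /=; first by rewrite inE => /eqP->.
case/allpairsPdep => v [j [/IHn vK + ->]]; rewrite mem_filter mem_iota /= => /andP[_ jK].
by rewrite mem_rcons inE => /predU1P[->|/vK].
Qed.

Lemma ballot_words_uniq K n : uniq (ballot_words K n).
Proof.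
elim: n => //= n IHn; apply: allpairs_uniq_dep => // [w _|].
  by rewrite filter_uniq ?iota_uniq.
by move=> [w i] [v j] _ _ /= /rcons_inj[-> ->].
Qed.

(** Extending each word by one letter multiplies the sum by the new length, by [ballot_number_up].
    The words being extended have length at most k, so they avoid the letter k: a ballot word
    containing it contains all k + 1 letters. *)
Lemma sum_ballot_number k n : n <= k.+1 ->
  \sum_(w <- ballot_words k.+1 n) ballot_number k.+1 n (content w) = n`!.
Proof.
elim: n => [|n IHn] nk.
  by rewrite big_seq1 ballot_number0 (introT (eq_shapeP _ _ _)).
rewrite sum_ballot_wordsS factS -IHn 1?ltnW // big_distrr /=.
rewrite big_seq [RHS]big_seq; apply: eq_bigr => w w_ballot.
have dec_w : decreasing k.+1 (content w).
  by rewrite -[w]take_size; apply: ballot_word_decreasing w_ballot.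
have w_k : content w k = 0.
  apply/eqP; rewrite -leqn0 leqNgt; apply: contraL nk => wk; rewrite -leqNgt.
  rewrite -(size_ballot_word w_ballot) -(size_iota 0 k.+1).
  apply: uniq_leq_size; first exact: iota_uniq.
  move=> i; rewrite mem_iota add0n /= -has_pred1 has_count => ik.
  exact: leq_trans wk (decreasing_le dec_w _ _).
rewrite -(ballot_number_up _ dec_w w_k) big_mkcond; apply: eq_bigr => i _.
rewrite (@eq_ballot_number _ _ _ (add_box (content w) i)) => [|x _]; last exact: content_rcons.
case: ifP => // /negbT ndec; rewrite ballot_number_not_decreasing //.
by rewrite -(@eq_decreasing _ (content (rcons w i))) // => x _; apply: content_rcons.
Qed.

Lemma ballot_number_widen K K' n f : 0 < K -> K <= K' -> (forall i, K <= i -> f i = 0) ->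
  ballot_number K' n f = ballot_number K n f.
Proof.
move=> K0 KK'; elim: n f => [|n IHn] f fK.
  rewrite !ballot_number0; congr nat_of_bool; apply/eq_shapeP/eq_shapeP => f0 i iK.
    exact: f0 (leq_trans iK KK').
  by have [/f0|/fK ->] := ltnP i K.
have dec_eq : decreasing K' f = decreasing K f.
  apply/decreasingP/decreasingP => dec_f i iK; first by apply: dec_f; lia.
  by have [/dec_f //|/fK ->] := ltnP i.+1 K.
case dec_f : (decreasing K f); last first.
  by rewrite !ballot_number_not_decreasing ?dec_eq ?dec_f.
rewrite !ballot_numberS ?dec_eq //.
rewrite (big_ord_widen_cond K' (fun i => 0 < f i) (fun i => ballot_number K n (del_box f i))) //.
rewrite big_mkcond [RHS]big_mkcond; apply: eq_bigr => i _.
have [iK|/fK ->] := ltnP i K; last by rewrite andbF.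
rewrite andbT; case: ifP => // _; apply: IHn => x /fK.
by rewrite /del_box => ->.
Qed.

Lemma ballot_number_gt0 K n f : decreasing K f -> \sum_(i < K) f i = n ->
  0 < ballot_number K n f.
Proof.
elim: n f => [|n IHn] f dec_f sum_f.
  rewrite ballot_number0 lt0b; apply/eq_shapeP => i iK.
  move/eqP: sum_f; rewrite sum_nat_eq0 => /forallP/(_ (Ordinal iK)) /eqP //.
have [i0 fi0] : exists i : 'I_K, 0 < f i.
  apply/existsP; apply: contraT; rewrite negb_exists => /forallP f0.
  suff : \sum_(i < K) f i = 0 by rewrite sum_f.
  by rewrite big1 // => i _; apply/eqP; rewrite -leqn0 leqNgt.
have [i fi i_max] := @arg_maxnP _ i0 (fun i : 'I_K => 0 < f i) (@nat_of_ord K) fi0.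
rewrite ballot_numberS // (bigD1 i) //= ltn_addr //; apply: IHn.
  apply/decreasingP => x xK; have /decreasingP/(_ x xK) := dec_f; rewrite /del_box.
  case: (eqVneq x i) => [xi|]; last lia.
  suff -> : f x.+1 = 0 by [].
  apply/eqP; rewrite -leqn0 leqNgt; apply/negP => fx.
  have := i_max (Ordinal xK) fx; rewrite /= -xi; lia.
have := sum_f; rewrite (bigD1 i) //= [in X in _ -> X](bigD1 i) //=.
under [X in _ -> _ + X = _]eq_bigr => j ji.
  rewrite /del_box (inj_eq val_inj) (negPf ji) subn0; over.
rewrite /del_box eqxx; lia.
Qed.

Lemma sum_content K w : all (fun i => i < K) w -> \sum_(i < K) content w i = size w.
Proof.
elim: w => [|a w IHw] /= => [_|/andP[aK /IHw <-]]; first by rewrite big1.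
rewrite /content /= big_split /= (bigD1 (Ordinal aK)) //= eqxx big1 ?addn0 // => i.
by rewrite -val_eqE /= eq_sym => /negPf->.
Qed.

Lemma ballot_word_shape K n w : w \in ballot_words K n ->
  exists2 l, is_partition n l & forall i, i < K -> nth 0 l i = content w i.
Proof.
move=> w_ballot; set f := content w.
have dec_f : decreasing K f.
  have := ballot_word_decreasing n w_ballot.
  by rewrite take_oversize // (size_ballot_word w_ballot).
pose m := find (fun i => f i == 0) (iota 0 K).
have mK : m <= K by rewrite -[X in _ <= X](size_iota 0) find_size.
have f_gt0 i : i < m -> 0 < f i.
  by move=> im; rewrite lt0n; have := before_find 0 im; rewrite nth_iota ?(leq_trans im) // => ->.
have f_eq0 i : m <= i -> i < K -> f i = 0.
  move=> mi iK; have m_lt : m < K by apply: leq_ltn_trans iK.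
  have /eqP fm : f m == 0.
    have := @nth_find _ 0 (fun i => f i == 0) (iota 0 K); rewrite has_find size_iota.
    by rewrite nth_iota // => /(_ m_lt).
  by apply/eqP; rewrite -leqn0 -fm; apply: decreasing_le dec_f mi iK.
exists (mkseq f m); last first.
  move=> i iK; have [im|mi] := ltnP i m; first by rewrite nth_mkseq.
  by rewrite nth_default ?size_mkseq // f_eq0.
apply/and3P; split.
- apply/(sortedP 0) => i; rewrite size_mkseq => im.
  rewrite !nth_mkseq ?(ltnW im) //; apply: decreasing_le dec_f (leqnSn i) _.
  exact: leq_trans im mK.
- by apply/mapP => -[i]; rewrite mem_iota /= => /f_gt0 + f0; rewrite -f0.
have w_K : all (fun i => i < K) w.
  by apply/allP => i; apply: ballot_word_letters w_ballot.
rewrite sumnE big_map -[m in iota 0 m]subn0 -/(index_iota 0 m) big_mkord.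
rewrite (big_ord_widen K f mK) -(size_ballot_word w_ballot) -(sum_content w_K).
rewrite big_mkcond; apply/eqP/eq_bigr => i _; case: ltnP => // mi.
by rewrite -/f f_eq0.
Qed.

Local Open Scope ring_scope.

(** * Tableaux and dominance *)

Section Cells.
Variables (n : nat) (p : intpart n).
Implicit Types (i : nat) (x y : 'I_n).

Definition cell_row x : nat := reshape_index p x.
Definition cell_col x : nat := reshape_offset p x.

Lemma sumn_intpart : sumn p = n.
Proof. by case: p => l /= /and3P[_ _ /eqP]. Qed.

Lemma intpart_nth_gt0 i : (i < size p)%N -> (0 < nth 0 p i)%N.
Proof.
case: p => l /= /and3P[_ l0 _] il; rewrite lt0n.
by apply: contraNneq l0 => <-; rewrite mem_nth.
Qed.

Lemma nth_intpart_le i j : (i <= j)%N -> (nth 0 p j <= nth 0 p i)%N.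
Proof.
move=> ij; have [jp|jp] := ltnP j (size p); last by rewrite nth_default.
case: p jp => l /= /and3P[sl _ _] jl.
have := @sorted_leq_nth _ geq (fun a b c ba ac => leq_trans ac ba) leqnn 0%N l sl.
by apply; rewrite ?inE // (leq_ltn_trans ij).
Qed.

Lemma intpart_eq (q : intpart n) : nth 0%N p =1 nth 0%N q -> p = q.
Proof.
move=> pq; apply: val_inj; apply: (@eq_from_nth _ 0%N) => [|i _]; last exact: pq.
apply/eqP; rewrite eqn_leq; apply/andP; split; rewrite leqNgt; apply/negP.
  move=> lt_qp; have := intpart_nth_gt0 lt_qp.
  by rewrite pq nth_default.
move=> lt_pq; have : (0 < nth 0 q (size p))%N.
  case: q lt_pq {pq} => l /= /and3P[_ l0 _] il; rewrite lt0n.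
  by apply: contraNneq l0 => <-; rewrite mem_nth.
by rewrite -pq nth_default.
Qed.

Lemma cell_row_lt x : (cell_row x < size p)%N.
Proof. by apply: reshape_indexP; rewrite sumn_intpart. Qed.

Lemma cell_col_lt x : (cell_col x < nth 0 p (cell_row x))%N.
Proof. by apply: reshape_offsetP; rewrite sumn_intpart. Qed.

Lemma cell_inj x y : cell_row x = cell_row y -> cell_col x = cell_col y -> x = y.
Proof.
move=> rxy cxy; apply: val_inj.
by rewrite /= -(reshape_indexK p x) -(reshape_indexK p y) -/(cell_row x) rxy -/(cell_col x) cxy.
Qed.

Lemma cell_exists r c : (c < nth 0 p r)%N -> {x | cell_row x = r & cell_col x = c}.
Proof.
move=> crp; have lt_n : (flatten_index p r c < n)%N.
  by rewrite -[X in (_ < X)%N]sumn_intpart flatten_indexP.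
exists (Ordinal lt_n); rewrite /cell_row /cell_col /=.
  by rewrite flatten_indexKl.
by rewrite flatten_indexKr.
Qed.

Lemma cell_above r x : (r <= cell_row x)%N ->
  {y | cell_row y = r & cell_col y = cell_col x}.
Proof.
by move=> rx; apply: cell_exists; apply: leq_trans (cell_col_lt x) (nth_intpart_le rx).
Qed.

Lemma card_row_cells r : #|[set x | cell_row x == r]| = nth 0%N p r.
Proof.
rewrite -[RHS]card_ord; pose f (j : 'I_(nth 0%N p r)) := s2val (cell_exists (ltn_ord j)).
have fr j : cell_row (f j) = r by rewrite /f; case: cell_exists.
have fc j : cell_col (f j) = j by rewrite /f; case: cell_exists.
have f_inj : injective f by move=> i j /(congr1 cell_col); rewrite !fc => /val_inj.
rewrite -(card_codom f_inj); apply: eq_card => x; rewrite inE.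
apply/eqP/codomP => [xr|[j ->]]; last exact: fr.
have cx : (cell_col x < nth 0 p r)%N by rewrite -xr cell_col_lt.
by exists (Ordinal cx); apply: cell_inj; rewrite ?fr ?fc.
Qed.

Definition first_rows i := #|[set x | (cell_row x < i)%N]|.

Lemma first_rowsS i : first_rows i.+1 = (first_rows i + nth 0 p i)%N.
Proof.
rewrite -card_row_cells /first_rows -cardsUI.
have -> : [set x | (cell_row x < i)%N] :&: [set x | cell_row x == i] = set0.
  by apply/setP => x; rewrite !inE; apply/negbTE; case: ltngtP.
rewrite cards0 addn0; congr #|pred_of_set _|; apply/setP => x.
by rewrite !inE ltnS leq_eqVlt orbC.
Qed.

End Cells.

Section Dominance.
Variables (n : nat) (p q : intpart n) (h : {perm 'I_n}).
Hypothesis h_inj : forall x y, cell_col q x = cell_col q y ->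
  cell_row p (h x) = cell_row p (h y) -> x = y.

(** If column j reaches row i, its first i rows hold i cells, and the left side is at most i because
    its cells go to distinct rows. Otherwise the whole column lies in the first i rows. *)
Lemma column_dominance (i j : nat) :
  (#|[set x | (cell_col q x == j) && (cell_row p (h x) < i)%N]| <=
   #|[set x | (cell_col q x == j) && (cell_row q x < i)%N]|)%N.
Proof.
case: (pickP [pred x | (cell_col q x == j) && (i <= cell_row q x)%N]) => [x0 /=|none].
  move=> /andP[/eqP jx0 ix0]; apply: (@leq_trans #|'I_i|).
    pose f x : option 'I_i := insub (cell_row p (h x)).
    rewrite -(card_in_imset (f := f)) => [|x y].
      rewrite -[X in (_ <= X)%N](card_imset _ (@Some_inj _)); apply/subset_leq_card.
      apply/subsetP => _ /imsetP[x + ->]; rewrite inE => /andP[_ xi].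
      by rewrite /f (insubT (fun r => r < i)%N xi) imset_f.
    rewrite !inE => /andP[/eqP jx xi] /andP[/eqP jy yi].
    rewrite /f (insubT (fun r => r < i)%N xi) (insubT (fun r => r < i)%N yi) => -[rxy].
    by apply: h_inj => //; rewrite jx jy.
  pose g (r : 'I_i) := s2val (cell_above (leq_trans (ltnW (ltn_ord r)) ix0)).
  have gr r : cell_row q (g r) = r by rewrite /g; case: cell_above.
  have gc r : cell_col q (g r) = j by rewrite /g -jx0; case: cell_above.
  have g_inj : injective g.
    by move=> r s /(congr1 (@cell_row _ q)); rewrite !gr => /val_inj.
  rewrite -(card_codom g_inj); apply/subset_leq_card/subsetP => _ /codomP[r ->].
  by rewrite inE gr gc eqxx ltn_ord.
apply/subset_leq_card/subsetP => x; rewrite !inE => /andP[xj _].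
by rewrite xj /= ltnNge; have /= := none x; rewrite xj /= => ->.
Qed.

Lemma sum_columns (P : pred 'I_n) :
  #|[set x | P x]| = (\sum_(j < n) #|[set x | (cell_col q x == j) && P x]|)%N.
Proof.
have col_n x : (cell_col q x < n)%N by rewrite (leq_ltn_trans (leq_subr _ _)).
rewrite -sum1_card (partition_big (fun x => Ordinal (col_n x)) xpredT) //=.
apply: eq_bigr => j _; rewrite -sum1_card; apply: eq_bigl => x.
by rewrite !inE andbC.
Qed.

Lemma dominance i : (first_rows p i <= first_rows q i)%N.
Proof.
rewrite /first_rows [X in (_ <= X)%N]sum_columns.
have -> : #|[set x | (cell_row p x < i)%N]| = #|[set x | (cell_row p (h x) < i)%N]|.
  rewrite -(card_preimset [set x | (cell_row p x < i)%N] (@perm_inj _ h)).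
  by apply: eq_card => x; rewrite !inE.
by rewrite sum_columns leq_sum // => j _; apply: column_dominance.
Qed.

End Dominance.

(** With equal shapes the column inequalities sum to an equality, so each is an equality. Hence the
    cells of a column can be rearranged inside that column so as to reach the rows prescribed by
    [h]: this factors [h] into a column and a row permutation. *)
Lemma dominance_split n (p : intpart n) (h : {perm 'I_n}) :
  (forall x y, cell_col p x = cell_col p y ->
     cell_row p (h x) = cell_row p (h y) -> x = y) ->
  exists2 t : {perm 'I_n}, (forall x, cell_col p (t x) = cell_col p x) &
    forall x, cell_row p (t x) = cell_row p (h x).
Proof.
move=> h_inj.
pose A i j := [set x | (cell_col p x == j) && (cell_row p (h x) < i)%N].
pose B i j := [set x | (cell_col p x == j) && (cell_row p x < i)%N].
have eqAB i (j : 'I_n) : #|A i j| = #|B i j|.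
  have leAB j' : (#|A i j'| <= #|B i j'| ?= iff (#|A i j'| == #|B i j'|))%N.
    by split; rewrite ?column_dominance.
  have [_] := @leqif_sum _ xpredT (fun j : 'I_n => #|A i j| == #|B i j|)
    (fun j : 'I_n => #|A i j|) (fun j : 'I_n => #|B i j|) (fun j _ => leAB j).
  have -> : (\sum_(i0 < n) #|A i i0| == \sum_(i0 < n) #|B i i0|)%N.
    rewrite -!(@sum_columns _ p); apply/eqP.
    rewrite -[RHS](card_preimset _ (@perm_inj _ h)).
    by apply: eq_card => x; rewrite !inE.
  by move/esym/forallP/(_ j)/eqP.
(* With [x1] the lowest cell in the column of [x], the equality of cardinals at row
   [cell_row p x1 + 1] says that [h] sends no cell of this column below [x1]. *)
have cellx x : (cell_col p x < nth 0 p (cell_row p (h x)))%N.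
  have [x1 /eqP x1x x1max] := @arg_maxnP _ x 
    (fun y => cell_col p y == cell_col p x) (@cell_row _ p) (eqxx _).
  have col_n : (cell_col p x < n)%N by rewrite (leq_ltn_trans (leq_subr _ _)).
  have sAB : A (cell_row p x1).+1 (cell_col p x) \subset B (cell_row p x1).+1 (cell_col p x).
    apply/subsetP => y; rewrite !inE => /andP[yx _]; rewrite yx ltnS.
    exact: x1max.
  have /eqP/setP/(_ x) : A (cell_row p x1).+1 (cell_col p x) == B (cell_row p x1).+1 (cell_col p x).
    by rewrite eqEcard sAB /=; have /= <- := eqAB (cell_row p x1).+1 (Ordinal col_n).
  have x_x1 : (cell_row p x <= cell_row p x1)%N := x1max x (eqxx _).
  rewrite !inE eqxx /= !ltnS x_x1 => hx.
  rewrite -x1x; apply: leq_trans (cell_col_lt p x1) _.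
  exact: nth_intpart_le.
pose f x := s2val (cell_exists (cellx x)).
have fr x : cell_row p (f x) = cell_row p (h x) by rewrite /f; case: cell_exists.
have fc x : cell_col p (f x) = cell_col p x by rewrite /f; case: cell_exists.
have f_inj : injective f.
  by move=> x y fxy; apply: h_inj; rewrite -(fc x, fr x) -(fc y, fr y) fxy.
by exists (perm f_inj) => x; rewrite permE.
Qed.

(** * The group ring *)

Section GroupRing.
Variable gT : finGroupType.
Local Notation G := [set: gT]%G.
Local Notation aG := (regular_repr algC G).
Local Notation R_G := (group_ring algC G).

(** An element of the group ring is handled through its matrix in the regular representation; its
    coefficients are the coordinates of the image of the identity. *)
Definition gcoef (Z : 'M[algC]_#|G|) (g : gT) : algC :=
  gring_row Z 0 (gring_index G g).

Lemma gcoefD Z1 Z2 g : gcoef (Z1 + Z2) g = gcoef Z1 g + gcoef Z2 g.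
Proof. by rewrite /gcoef linearD mxE. Qed.

Lemma gcoefZ a Z g : gcoef (a *: Z) g = a * gcoef Z g.
Proof. by rewrite /gcoef linearZ mxE. Qed.

Lemma gcoef_sum I r (P : pred I) Z g :
  gcoef (\sum_(i <- r | P i) Z i) g = \sum_(i <- r | P i) gcoef (Z i) g.
Proof. by rewrite /gcoef linear_sum summxE. Qed.

Lemma gcoefG h g : gcoef (aG h) g = (g == h)%:R.
Proof.
rewrite /gcoef /gring_row rowK gring_indexK ?inE // mul1g mxE eqxx /=.
by rewrite (can_in_eq (gring_indexK (G := G))) ?inE.
Qed.

Lemma group_ringP Z : reflect (exists a, Z = \sum_g a g *: aG g) (Z \in R_G)%MS.
Proof.
apply: (iffP envelop_mxP) => -[a ->]; exists a; apply: eq_bigl => g;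
  by rewrite inE.
Qed.

Lemma group_ring_sum Z : (Z \in R_G)%MS -> Z = \sum_g gcoef Z g *: aG g.
Proof.
case/group_ringP => a {1 2}->; apply: eq_bigr => g _; congr (_ *: _).
rewrite gcoef_sum (bigD1 g) //= gcoefZ gcoefG eqxx mulr1 big1 ?addr0 // => h hg.
by rewrite gcoefZ gcoefG eq_sym (negPf hg) mulr0.
Qed.

Lemma group_ring_eq0 Z : (Z \in R_G)%MS -> (forall g, gcoef Z g = 0) -> Z = 0.
Proof.
move=> RZ Z0; rewrite (group_ring_sum RZ) big1 // => g _.
by rewrite Z0 scale0r.
Qed.

Lemma gcoefJ s Z t g : (Z \in R_G)%MS ->
  gcoef (aG s *m Z *m aG t) g = gcoef Z (s^-1 * g * t^-1)%g.
Proof.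
case/group_ringP => a ->; rewrite mulmx_sumr mulmx_suml !gcoef_sum.
apply: eq_bigr => h _; rewrite -scalemxAr -scalemxAl -!repr_mxM ?inE //.
rewrite !gcoefZ !gcoefG; congr (_ * (_ : bool)%:R).
by rewrite -[RHS](inj_eq (mulgI s)) -[RHS](inj_eq (mulIg t)) !mulgA mulgV mul1g mulgKV.
Qed.

Lemma gcoefJl s Z g : (Z \in R_G)%MS -> gcoef (aG s *m Z) g = gcoef Z (s^-1 * g)%g.
Proof.
by move=> RZ; rewrite -[_ *m Z]mulmx1 -(repr_mx1 aG) gcoefJ // invg1 mulg1.
Qed.

Lemma gcoefJr Z t g : (Z \in R_G)%MS -> gcoef (Z *m aG t) g = gcoef Z (g * t^-1)%g.
Proof.
by move=> RZ; rewrite -[Z]mul1mx -(repr_mx1 aG) gcoefJ // invg1 mul1g repr_mx1 mul1mx.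
Qed.

(** On the group ring this is the conjugate-linear involution that inverts group elements. It brings
    in the positivity that makes products such as [M *m adjmx M] nonzero. *)
Definition adjmx m (M : 'M[algC]_m) : 'M[algC]_m := (map_mx Num.conj M)^T.

Lemma mul_adjmx_eq0 m (M : 'M[algC]_m) : M *m adjmx M = 0 -> M = 0.
Proof.
move=> M0; apply/matrixP => i j; rewrite mxE.
have /matrixP/(_ i i) := M0; rewrite !mxE.
under eq_bigr do rewrite !mxE -normCK.
move/eqP; rewrite psumr_eq0 => [/allP/(_ j (mem_index_enum j)) /=|? _].
  by rewrite expf_eq0 normr_eq0 => /eqP.
by rewrite exprn_ge0.
Qed.

Lemma adjmxM m (M N : 'M[algC]_m) : adjmx (M *m N) = adjmx N *m adjmx M.
Proof. by rewrite /adjmx map_mxM trmx_mul. Qed.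

Lemma adjmxK m (M : 'M[algC]_m) : adjmx (adjmx M) = M.
Proof. by apply/matrixP => i j; rewrite !mxE conjCK. Qed.

Lemma mul_adjmx_mul_eq0 m (M : 'M[algC]_m) : M *m adjmx M *m M = 0 -> M = 0.
Proof.
move=> M0; apply: mul_adjmx_eq0; apply: mul_adjmx_eq0.
by rewrite adjmxM adjmxK mulmxA M0 mul0mx.
Qed.

Lemma adjmx_regular g : adjmx (aG g) = aG g^-1%g.
Proof.
apply/matrixP => i j; rewrite !mxE rmorph_nat eqxx /=; congr (nat_of_bool _)%:R.
rewrite -(inj_eq enum_val_inj) -[RHS](inj_eq enum_val_inj) !gring_indexK ?inE //.
by rewrite -[RHS](inj_eq (mulIg g)) mulgKV eq_sym.
Qed.

Lemma adjmx_group_ring Z : (Z \in R_G)%MS -> (adjmx Z \in R_G)%MS.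
Proof.
case/group_ringP => a ->; apply/group_ringP; exists (fun g => (a g^-1%g)^*).
rewrite (reindex_inj invg_inj) /= /adjmx map_mx_sum linear_sum.
apply: eq_bigr => g _; rewrite map_mxZ linearZ /=; congr (_ *: _).
by have := adjmx_regular g^-1; rewrite invgK.
Qed.

End GroupRing.

(** * Linear constituents of a restriction, from common eigenvectors *)

Section Eigenvector.
Variables (gT : finGroupType) (G H : {group gT}) (m : nat).
Variable rG : mx_representation algC G m.
Hypothesis sHG : H \subset G.

(** The span of [v] is a submodule affording [xi]; the quotient affords a character, which
    contributes a nonnegative amount. *)
Lemma cfdot_Res_eigenvector (xi : 'CF(H)) (v : 'rV_m) :
    xi \is a linear_char -> v != 0 -> (forall t, t \in H -> v *m rG t = xi t *: v) ->
  '['Res[H] (cfRepr rG), xi] != 0.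
Proof.
move=> lin_xi v0 vH; rewrite -cfRepr_sub; set rH := subg_repr rG sHG.
have modU : mxmodule rH <<v>>%MS.
  apply/mxmoduleP => t Ht; rewrite !genmxE (eqmxMr _ (genmxE v)) /=.
  by rewrite vH // scalemx_sub.
have -> : cfRepr rH = cfRepr (submod_repr modU) + cfRepr (factmod_repr modU).
  apply/cfun_inP => t Ht; rewrite !cfunE Ht !mulr1n.
  by rewrite mxtrace_sub_fact_mod.
have -> : cfRepr (submod_repr modU) = (\rank <<v>>%MS)%:R *: xi.
  apply/cfun_inP => t Ht; rewrite !cfunE Ht mulr1n /= /submod_mx.
  have [a Wa] : exists a, val_submod (1%:M : 'M_(\rank <<v>>%MS)) = a *m v.
    by apply/submxP; rewrite -(genmxE v) val_submodP.
  rewrite Wa -mulmxA vH // -scalemxAr -Wa linearZ /= val_submodK.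
  by rewrite mxtraceZ mxtrace1 mulrC.
rewrite cfdotDl cfdotZl (_ : '[xi, xi] = 1); last first.
  by have /irrP[i ->] := lin_char_irr lin_xi; rewrite cfnorm_irr.
have fact_ge0 := natr_ge0 (Cnat_cfdot_char (cfRepr_char (factmod_repr modU)) (lin_charW lin_xi)).
rewrite mulr1 gt_eqF // ltr_wpDr // ltr0n lt0n mxrank_eq0.
by rewrite -submx0 genmxE submx0.
Qed.

End Eigenvector.

(** * Specht characters *)

Section Sign.
Variable n : nat.
Implicit Types (H R C : {group 'S_n}).

Definition sign_mx (s : 'S_n) : 'M[algC]_1 := ((-1) ^+ odd_perm s)%:M.

Lemma sign_mx_repr H : mx_repr H sign_mx.
Proof.
split=> [|s t _ _]; first by rewrite /sign_mx odd_perm1.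
by rewrite /sign_mx odd_permM signr_addb -scalar_mxM.
Qed.

Definition sign_char H : 'CF(H) := cfRepr (MxRepresentation (sign_mx_repr H)).

Lemma sign_charE H s : sign_char H s = (-1) ^+ odd_perm s *+ (s \in H).
Proof. by rewrite cfunE mxtrace_scalar mulr1n. Qed.

Lemma sign_char_lin H : sign_char H \is a linear_char.
Proof. by rewrite qualifE /= cfRepr_char sign_charE group1 odd_perm1 eqxx. Qed.

Lemma sign_sum_eq0 H (P : pred 'S_n) t :
    t \in H -> odd_perm t -> (forall s, s \in H -> P (s * t)%g = P s) ->
  \sum_(s in H | P s) (-1) ^+ odd_perm s = 0 :> algC.
Proof.
move=> Ht odd_t Pt; set S := \sum_(s in H | P s) _.
suff eqS : S = - S.
  by apply/eqP; rewrite -[S == 0](mulrn_eq0 S 2) mulr2n {1}eqS addNr.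
rewrite {1}/S (reindex_inj (mulIg t)) /= -sumrN; apply: eq_big => [s|s].
  by rewrite groupMr //; apply: andb_id2l => /Pt.
by rewrite odd_permM odd_t addbT signrN.
Qed.

(** By Frobenius reciprocity the product is, up to a factor, a sum over g of the sums of signs over
    the s in [R] with [s ^ g] in [C]. Translation by an odd element of this kind cancels each of
    them. *)
Lemma cfdot_Ind_sign_eq0 R C :
    (forall g, exists2 t, t \in R & (t ^ g \in C)%g && odd_perm t) ->
  '['Ind[[set: 'S_n]] (1 : 'CF(R)), 'Ind[[set: 'S_n]] (sign_char C)] = 0.
Proof.
move=> RC; rewrite -Frobenius_reciprocity cfdotE.
set S := (X in _ * X); suff -> : S = 0 by rewrite mulr0.
rewrite {}/S; under eq_bigr => x Rx.
  rewrite cfResE ?subsetT // cfIndE ?subsetT // cfun1E Rx mul1r rmorphM rmorph_sum /=.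
  over.
rewrite -mulr_sumr exchange_big /= big1 ?mulr0 // => g _.
have [t Rt /andP[Ct odd_t]] := RC g.
under eq_bigr do rewrite sign_charE rmorphMn rmorph_sign odd_permJ mulrb.
rewrite -big_mkcondr; apply: (sign_sum_eq0 Rt odd_t) => s _.
by rewrite conjMg groupMr.
Qed.

End Sign.

(** * Young symmetrizers *)

Section Young.
Variables (n : nat) (p : intpart n).
Local Notation G := [set: 'S_n]%G.
Local Notation aG := (regular_repr algC G).
Local Notation R_G := (group_ring algC G).
Local Notation R := (row_stabilizer p).
Local Notation C := (column_stabilizer p).

Lemma row_stabilizerP (s : 'S_n) :
  reflect (forall x, cell_row p (s x) = cell_row p x) (s \in R).
Proof.
by rewrite inE; apply: (iffP forallP) => Hs x; apply/eqP; apply: Hs.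
Qed.

Lemma column_stabilizerP (s : 'S_n) :
  reflect (forall x, cell_col p (s x) = cell_col p x) (s \in C).
Proof.
by rewrite inE; apply: (iffP forallP) => Hs x; apply/eqP; apply: Hs.
Qed.

Lemma row_stabilizer_group_set : group_set R.
Proof.
apply/group_setP; split=> [|s t /row_stabilizerP Rs /row_stabilizerP Rt].
  by apply/row_stabilizerP => x; rewrite perm1.
by apply/row_stabilizerP => x; rewrite permM Rt Rs.
Qed.
Canonical row_stabilizer_group := Group row_stabilizer_group_set.

Lemma column_stabilizer_group_set : group_set C.
Proof.
apply/group_setP; split=> [|s t /column_stabilizerP Cs /column_stabilizerP Ct].
  by apply/column_stabilizerP => x; rewrite perm1.
by apply/column_stabilizerP => x; rewrite permM Ct Cs.
Qed.
Canonical column_stabilizer_group := Group column_stabilizer_group_set.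

Lemma row_column_trivial (s t : 'S_n) : s \in R -> t \in C -> (s * t)%g = 1%g -> t = 1%g.
Proof.
move=> /row_stabilizerP Rs /column_stabilizerP Ct st1; apply/permP => x.
rewrite perm1; apply: (@cell_inj _ p); last exact: Ct.
rewrite -(Rs (t x)) -permM; congr (cell_row p _).
have : (t * s = 1)%g by apply: (mulgI s); rewrite mulgA st1 mul1g mulg1.
by move=> ->; rewrite perm1.
Qed.

Lemma tperm_row_stabilizer x y : cell_row p x = cell_row p y -> tperm x y \in R.
Proof.
by move=> xy; apply/row_stabilizerP => z; case: tpermP => // ->.
Qed.

Lemma tperm_column_stabilizer x y : cell_col p x = cell_col p y -> tperm x y \in C.
Proof.
by move=> xy; apply/column_stabilizerP => z; case: tpermP => // ->.
Qed.

Definition row_sum : 'M[algC]_#|G| := \sum_(s in R) aG s.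
Definition column_sum : 'M[algC]_#|G| := \sum_(t in C) (-1) ^+ odd_perm t *: aG t.
Definition young_mx := row_sum *m column_sum.

Lemma young_mxE :
  young_mx = \sum_(s in R) \sum_(t in C) (-1) ^+ odd_perm t *: aG (s * t)%g.
Proof.
rewrite /young_mx mulmx_suml; apply: eq_bigr => s _.
rewrite mulmx_sumr; apply: eq_bigr => t _.
by rewrite -scalemxAr repr_mxM ?inE.
Qed.

Lemma gring_row_young : gring_row young_mx = young_symmetrizer p.
Proof.
rewrite young_mxE linear_sum; apply: eq_bigr => s _.
by rewrite linear_sum; apply: eq_bigr => t _; rewrite linearZ.
Qed.

Lemma row_sum_ring : (row_sum \in R_G)%MS.
Proof. by rewrite linear_sum summx_sub // => s _; rewrite envelop_mx_id ?inE. Qed.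

Lemma column_sum_ring : (column_sum \in R_G)%MS.
Proof.
rewrite linear_sum summx_sub // => s _.
by rewrite linearZ scalemx_sub // envelop_mx_id ?inE.
Qed.

Lemma young_ring : (young_mx \in R_G)%MS.
Proof. by rewrite envelop_mxM ?row_sum_ring ?column_sum_ring. Qed.

Lemma row_sumJ s : s \in R -> aG s *m row_sum = row_sum.
Proof.
move=> Rs; rewrite /row_sum mulmx_sumr [RHS](reindex_inj (mulgI s)) /=.
apply: eq_big => [t|t _]; first by rewrite groupMl.
by rewrite repr_mxM ?inE.
Qed.

Lemma column_sumJ t : t \in C -> column_sum *m aG t = (-1) ^+ odd_perm t *: column_sum.
Proof.
move=> Ct; rewrite /column_sum mulmx_suml scaler_sumr [RHS](reindex_inj (mulIg t)) /=.
apply: eq_big => [s|s _]; first by rewrite groupMr.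
rewrite -scalemxAl scalerA odd_permM signr_addb repr_mxM ?inE //.
by rewrite mulrCA -signr_addb addbb mulr1.
Qed.

(* An element with the symmetries of the Young symmetrizer is supported on    *)
(* the products of a row and a column permutation, hence determined by its    *)
(* coefficient at the identity.                                               *)
Lemma young_symmetry_eq0 Z : (Z \in R_G)%MS ->
    (forall s, s \in R -> aG s *m Z = Z) ->
    (forall t, t \in C -> Z *m aG t = (-1) ^+ odd_perm t *: Z) ->
  gcoef Z 1%g = 0 -> Z = 0.
Proof.
move=> RZ ZR ZC Z1; apply: group_ring_eq0 => // g.
have coefR s h : s \in R -> gcoef Z (s * h)%g = gcoef Z h.
  move=> Rs; rewrite -{1}(ZR _ Rs) gcoefJl //; congr gcoef.
  by rewrite mulgA mulVg mul1g.
have coefC t h : t \in C -> gcoef Z (h * t)%g = (-1) ^+ odd_perm t * gcoef Z h.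
  move=> Ct; rewrite -[t in LHS]invgK -gcoefJr // ZC ?groupV //.
  by rewrite gcoefZ odd_permV.
(* For such a pair the transposition lies in the column group and its conjugate by [g^-1] in the row
   group, so the coefficient at [g] is its own negative. Without such a pair, [g] is a row
   permutation times a column permutation. *)
case: (pickP [pred z | [&& z.1 != z.2, cell_col p z.1 == cell_col p z.2 &
    cell_row p (g^-1%g z.1) == cell_row p (g^-1%g z.2)]]) => [[x y] /=|none].
  case/and3P => xy /eqP cxy /eqP rxy; have Ct := tperm_column_stabilizer cxy.
  have := coefC _ g Ct; rewrite conjgCV tpermJ coefR ?tperm_row_stabilizer //.
  rewrite odd_tperm xy mulN1r => /eqP; rewrite -subr_eq0 opprK -mulr2n mulrn_eq0.
  by move/eqP.
have [x y cxy rxy|t Ct Rt] := @dominance_split _ p g^-1%g.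
  apply/eqP; have := none (x, y); rewrite /= cxy rxy !eqxx !andbT.
  by move/negbFE.
have {}Ct : t \in C by apply/column_stabilizerP.
have Rs : (g * t)%g \in R.
  apply/row_stabilizerP => x; rewrite permM Rt -permM mulgV perm1 //.
have := coefC _ g Ct; rewrite -[(g * t)%g]mulg1 coefR // Z1 => /esym/eqP.
by rewrite mulf_eq0 signr_eq0 => /eqP.
Qed.

End Young.

Section Specht.
Variables (n : nat) (p : intpart n).
Local Notation G := [set: 'S_n]%G.
Local Notation aG := (regular_repr algC G).
Local Notation R_G := (group_ring algC G).
Local Notation R := (row_stabilizer p).
Local Notation C := (column_stabilizer p).
Local Notation c := (young_mx p).

Lemma gcoef_young g : gcoef c g =
  \sum_(s in R) \sum_(t in C) (-1) ^+ odd_perm t * (g == s * t)%g%:R.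
Proof.
rewrite young_mxE gcoef_sum; apply: eq_bigr => s _.
by rewrite gcoef_sum; apply: eq_bigr => t _; rewrite gcoefZ gcoefG.
Qed.

Lemma gcoef_young1 : gcoef c 1%g = 1.
Proof.
rewrite gcoef_young (bigD1 1%g) ?group1 //= (bigD1 1%g) ?group1 //=.
rewrite mulg1 eqxx odd_perm1 expr0 mulr1 !big1 ?addr0 //.
  move=> s /andP[Rs s1]; rewrite big1 // => t Ct; case: eqP => [/esym st1|]; last by rewrite mulr0.
  have t1 := row_column_trivial Rs Ct st1.
  by move: st1 s1; rewrite t1 mulg1 => ->; rewrite eqxx.
by move=> t /andP[Ct t1]; rewrite mul1g eq_sym (negPf t1) mulr0.
Qed.

Lemma gcoef_young_neq0 g : gcoef c g != 0 ->
  exists s t, [/\ s \in R, t \in C & g = (s * t)%g].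
Proof.
rewrite gcoef_young => c0.
have [s Rs] : exists2 s, s \in R &
    \sum_(t in C) (-1) ^+ odd_perm t * (g == s * t)%g%:R != 0 :> algC.
  apply/exists_inP; apply: contraR c0 => /exists_inPn s0.
  by rewrite big1 // => s Rs; apply/eqP; have := s0 s Rs; rewrite negbK.
move=> s0; have [t Ct gst] : exists2 t, t \in C & g == (s * t)%g.
  apply/exists_inP; apply: contraR s0 => /exists_inPn t0.
  by rewrite big1 // => t Ct; rewrite (negPf (t0 t Ct)) mulr0.
by exists s, t; rewrite Rs Ct (eqP gst).
Qed.

Lemma young_neq0 : c != 0.
Proof.
apply: contraTneq (oner_neq0 algC) => c0; rewrite -gcoef_young1 c0.
by rewrite /gcoef linear0 mxE eqxx.
Qed.

(** The product inherits the left symmetry from the first factor [c] and the right one from the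
    last. As [c] has coefficient 1 at the identity, the scalar is the coefficient of the product
    there. *)
Lemma young_sandwich X : (X \in R_G)%MS -> exists a, c *m X *m c = a *: c.
Proof.
move=> RX; exists (gcoef (c *m X *m c) 1%g).
have RcXc : (c *m X *m c \in R_G)%MS.
  exact: envelop_mxM (envelop_mxM (young_ring p) RX) (young_ring p).
set Z := c *m X *m c in RcXc *; pose b := gcoef Z 1%g.
suff : Z - b *: c = 0 by move/eqP; rewrite subr_eq0 => /eqP.
apply: (@young_symmetry_eq0 _ p).
- by rewrite linearB linearZ addmx_sub ?eqmx_opp ?scalemx_sub ?young_ring.
- move=> s Rs; rewrite mulmxBr -scalemxAr /Z /young_mx !mulmxA !row_sumJ //.
- move=> t Ct; rewrite mulmxBl -scalemxAl /Z /young_mx -!mulmxA !column_sumJ //.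
  by rewrite -!scalemxAr scalerBr !scalerA mulrC !mulmxA.
rewrite -scaleN1r gcoefD !gcoefZ gcoef_young1 mulr1 mulN1r.
by rewrite addrN.
Qed.

Local Notation U := (cyclic_mx aG (young_symmetrizer p)).

Lemma specht_mxsimple : mxsimple aG U.
Proof.
split; first exact: cyclic_mx_module.
  rewrite cyclic_mx_eq0 -gring_row_young; apply: contraNneq young_neq0 => c0.
  by rewrite -(gring_rowK (young_ring p)) c0 linear0.
move=> V modV sVU /rowV0Pn[v Vv v0].
rewrite cyclic_mx_sub // -gring_row_young.
have /cyclic_mxP[y Ry def_v] := submx_trans Vv sVU.
pose M := c *m y.
have RM : (M \in R_G)%MS by rewrite envelop_mxM ?young_ring.
have def_M : v = gring_row M by rewrite gring_row_mul gring_row_young.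
have M0 : M != 0 by apply: contraNneq v0 => M0; rewrite def_M M0 linear0.
(* A nonzero element M of the right ideal generates c, as positivity of       *)
(* M *m adjmx M prevents the scalar a from vanishing.                         *)
have [a Ma] : exists a, M *m adjmx M *m c = a *: c.
  rewrite /M -(mulmxA c); apply: young_sandwich.
  by rewrite envelop_mxM ?adjmx_group_ring.
have a0 : a != 0.
  apply: contraNneq M0 => a0; apply/eqP/mul_adjmx_mul_eq0; rewrite {3}/M mulmxA Ma a0 scale0r.
  by rewrite mul0mx.
rewrite -[c](scalerK a0) -Ma -mulmxA linearZ scalemx_sub //= gring_row_mul -def_M.
apply: mxmodule_envelop modV _ Vv.
by rewrite envelop_mxM ?adjmx_group_ring ?young_ring.
Qed.

Lemma specht_irr : specht_char p \in irr G.
Proof.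
apply/irr_reprP.
exists (Representation (submod_repr (cyclic_mx_module aG (young_symmetrizer p)))) => //.
exact/submod_mx_irr/specht_mxsimple.
Qed.

Lemma cfdot_Res_specht (H : {group 'S_n}) (xi : 'CF(H)) X :
    xi \is a linear_char -> (X \in R_G)%MS -> c *m X != 0 ->
    (forall t, t \in H -> c *m X *m aG t = xi t *: (c *m X)) ->
  '['Res[H] (specht_char p), xi] != 0.
Proof.
move=> lin_xi RX X0 XH; set modU := cyclic_mx_module aG (young_symmetrizer p).
have sXU : (gring_row (c *m X) <= U)%MS.
  by apply/cyclic_mxP; exists X; rewrite // gring_row_mul gring_row_young.
apply: (@cfdot_Res_eigenvector _ _ _ _ _ (subsetT H) _ (in_submod U (gring_row (c *m X)))) => //.
  apply: contraNneq X0 => /(congr1 val_submod); rewrite in_submodK // linear0.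
  move=> X0; rewrite -[c *m X](gring_rowK (G := G)) ?X0 ?linear0 //.
  by rewrite envelop_mxM ?young_ring.
by move=> t Ht; rewrite -in_submodJ // -gring_row_mul XH // !linearZ.
Qed.

(** The invariant vector is [c *m adjmx c]: it ends with the adjoint of the row sum, which absorbs
    row permutations on the right, and it is nonzero by positivity. *)
Lemma specht_row_constt : '['Res[row_stabilizer_group p] (specht_char p), 1] != 0.
Proof.
apply: (@cfdot_Res_specht _ _ (adjmx c)).
- by rewrite rpred1.
- by rewrite adjmx_group_ring ?young_ring.
- apply: contraNneq young_neq0 => /mul_adjmx_eq0-> //.
move=> s Rs; rewrite cfun1E Rs scale1r /young_mx adjmxM -!mulmxA; congr (_ *m (_ *m (_ *m _))).
by rewrite -{2}(row_sumJ (groupVr Rs)) adjmxM adjmx_regular invgK.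
Qed.

Lemma specht_column_constt (H : {group 'S_n}) : H \subset C ->
  '['Res[H] (specht_char p), sign_char H] != 0.
Proof.
move=> sHC; apply: (@cfdot_Res_specht _ _ 1%:M).
- exact: sign_char_lin.
- exact: envelop_mx1.
- by rewrite mulmx1 young_neq0.
move=> t Ht; rewrite mulmx1 sign_charE Ht mulr1n.
by rewrite /young_mx -mulmxA column_sumJ ?(subsetP sHC) // -scalemxAr.
Qed.

End Specht.

(** If the characters of [p] and [q] agree, this character occurs both in the one induced from the
    trivial character of the rows of [p] and in the one induced from the sign of the columns of [q].
    These are then not orthogonal, which yields a permutation as required by [dominance]. By
    symmetry each shape dominates the other. *)
Lemma specht_inj n : injective (@specht_char n).
Proof.
move=> p q eq_pq.
have dom (p' q' : intpart n) i : specht_char p' = specht_char q' ->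
    (first_rows p' i <= first_rows q' i)%N.
  move=> eq_pq'; set G := [set: 'S_n]%G.
  have [h h_inj] : exists h : 'S_n, forall x y, cell_col q' x = cell_col q' y ->
      cell_row p' (h x) = cell_row p' (h y) -> x = y.
    have /irrP[j chi_j] := specht_irr q'.
    pose phi := 'Ind[G] (1 : 'CF(row_stabilizer_group p')).
    pose psi := 'Ind[G] (sign_char (column_stabilizer_group q')).
    have phi_j : j \in irr_constt phi.
      rewrite irr_consttE -chi_j -eq_pq' -Frobenius_reciprocity.
      by rewrite cfdotC fmorph_eq0 specht_row_constt.
    have psi_j : j \in irr_constt psi.
      rewrite irr_consttE -chi_j -Frobenius_reciprocity.
      by rewrite cfdotC fmorph_eq0 specht_column_constt.
    have phi_psi : '[phi, psi] != 0.
      apply/eqP => phi_psi0.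
      have := constt_ortho_char _ _ phi_j psi_j phi_psi0.
      rewrite !cfInd_char ?rpred1 ?lin_charW ?sign_char_lin // => /(_ isT isT).
      by move/eqP; rewrite cfnorm_irr oner_eq0.
    case: (pickP [pred h : 'S_n | [forall x, forall y, (cell_col q' x == cell_col q' y) ==>
        ((cell_row p' (h x) == cell_row p' (h y)) ==> (x == y))]]) => [h /= /forallP h_inj|none].
      exists h => x y /eqP cxy /eqP rxy; apply/eqP.
      by have /forallP/(_ y)/implyP/(_ cxy)/implyP/(_ rxy) := h_inj x.
    case/eqP: phi_psi; apply: cfdot_Ind_sign_eq0 => g.
    have /negbT/forallPn[x /forallPn[y]] := none g^-1%g.
    rewrite !negb_imply => /and3P[/eqP cxy /eqP rxy xy].
    exists (tperm (g^-1%g x) (g^-1%g y)); first exact: tperm_row_stabilizer.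
    by rewrite tpermJ !permKV tperm_column_stabilizer // odd_tperm (inj_eq perm_inj).
  exact: (dominance h_inj).
apply: intpart_eq => i; apply/eqP; rewrite -(eqn_add2l (first_rows p i)) -first_rowsS.
have e j : first_rows p j = first_rows q j by apply/eqP; rewrite eqn_leq !dom.
by rewrite !e -first_rowsS.
Qed.

Lemma lexi_first_difference (s t : seq nat) x : size s = size t ->
    (forall z, (z < x)%N -> nth 0%N s z = nth 0%N t z) -> (nth 0%N s x < nth 0%N t x)%N ->
  ((s : seqlexi nat) < t)%O.
Proof.
elim: s t x => [|a s IHs] [|b t] //= x; first by rewrite nth_nil ltn0.
case=> st; rewrite ltxi_cons /=; case: x => [|x] eq_st /= lt_st.
  by rewrite !leEnat (ltnW lt_st) leqNgt lt_st.
have /= -> := eq_st 0%N isT; rewrite lexx /=.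
by apply: IHs lt_st => // z zx; apply: (eq_st z.+1).
Qed.

(** * Independence of the standard polytabloids *)

Section SpechtDegree.
Variables (n K : nat) (p : intpart n).
Hypothesis size_p : (size p <= K)%N.
Local Notation G := [set: 'S_n]%G.
Local Notation aG := (regular_repr algC G).
Local Notation c := (young_mx p).

Definition standard_words :=
  [seq w <- ballot_words K n | eq_shape K (content w) (nth 0%N p)].

Lemma size_standard_words : size standard_words = ballot_number K n (nth 0%N p).
Proof. by rewrite size_filter. Qed.

Lemma standard_word_size w : w \in standard_words -> size w = n.
Proof. by rewrite mem_filter => /andP[_ /size_ballot_word]. Qed.

(** The column of the entry x in the tableau of [w]: earlier equal letters are the boxes to its
    left. *)
Definition occurrence (w : seq nat) x := count_mem (nth 0%N w x) (take x w).

Lemma count_take_succ (w : seq nat) a x : (x < size w)%N ->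
  count_mem a (take x.+1 w) = (count_mem a (take x w) + (nth 0%N w x == a))%N.
Proof. by move=> xw; rewrite (take_nth 0%N xw) -cats1 count_cat /= addn0. Qed.

Lemma count_take_mono (w : seq nat) a x y : (x <= y)%N ->
  (count_mem a (take x w) <= count_mem a (take y w))%N.
Proof.
move=> xy; rewrite -[take x w](@take_takel _ x y) //.
by rewrite -[X in (_ <= count _ X)%N](cat_take_drop x) count_cat leq_addr.
Qed.

Lemma occurrence_lt w x : w \in standard_words -> (x < n)%N ->
  (occurrence w x < nth 0%N p (nth 0%N w x))%N.
Proof.
move=> wW xn; have w_n := standard_word_size wW.
move: wW; rewrite mem_filter => /andP[/eq_shapeP shape_w w_ballot].
rewrite -shape_w; last by apply: ballot_word_letters w_ballot _; rewrite mem_nth ?w_n.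
have := count_take_mono w (nth 0%N w x) (xn : (x.+1 <= n)%N).
by rewrite count_take_succ ?w_n // eqxx addn1 [take n w]take_oversize ?w_n.
Qed.

Lemma reading_perm_exists w : w \in standard_words -> exists q : 'S_n, forall x : 'I_n,
  cell_row p (q x) = nth 0%N w x /\ cell_col p (q x) = occurrence w x.
Proof.
move=> wW; have w_n := standard_word_size wW.
pose f x := s2val (cell_exists (occurrence_lt wW (ltn_ord x))).
have fr x : cell_row p (f x) = nth 0%N w x by rewrite /f; case: cell_exists.
have fc x : cell_col p (f x) = occurrence w x by rewrite /f; case: cell_exists.
have f_inj : injective f.
  have neq (x y : 'I_n) : f x = f y -> (x < y)%N -> False.
    move=> fxy xy; have r_xy : nth 0%N w x = nth 0%N w y by rewrite -!fr fxy.
    have : (occurrence w x < occurrence w y)%N.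
      apply: leq_trans (count_take_mono _ _ xy).
      by rewrite count_take_succ ?w_n // -r_xy eqxx addn1.
    by rewrite -!fc fxy ltnn.
  by move=> x y fxy; apply: val_inj; case: (ltngtP x y) => // /neq[].
by exists (perm f_inj) => x; rewrite permE.
Qed.

Definition reading_perm w : 'S_n := odflt 1%g [pick q : 'S_n |
  [forall x, (cell_row p (q x) == nth 0%N w x) && (cell_col p (q x) == occurrence w x)]].

Lemma reading_permP w x : w \in standard_words ->
  cell_row p (reading_perm w x) = nth 0%N w x /\
  cell_col p (reading_perm w x) = occurrence w x.
Proof.
move=> wW; rewrite /reading_perm; case: pickP => [q /forallP/(_ x)/andP[/eqP-> /eqP->] //|].
have [q qP] := reading_perm_exists wW.
by move/(_ q)/negP; case; apply/forallP => y; have [-> ->] := qP y; rewrite !eqxx.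
Qed.

(** Columns of a standard tableau increase downwards: the ballot condition on the prefix ending at
    [y] says that the upper row has reached this column already. *)
Lemma reading_column_lt w (x y : 'I_n) : w \in standard_words ->
    cell_col p (reading_perm w x) = cell_col p (reading_perm w y) ->
    (nth 0%N w x < nth 0%N w y)%N -> (x < y)%N.
Proof.
move=> wW; have [_ ->] := reading_permP x wW; have [_ ->] := reading_permP y wW.
move=> occ_xy w_xy; rewrite ltnNge; apply/negP => yx; have w_n := standard_word_size wW.
move: (wW); rewrite mem_filter => /andP[_ w_ballot].
have yK : (nth 0%N w y < K)%N by rewrite (ballot_word_letters w_ballot) ?mem_nth ?w_n.
have := decreasing_le (ballot_word_decreasing y.+1 w_ballot) (ltnW w_xy) yK.
rewrite /content count_take_succ ?w_n // eqxx addn1 -/(occurrence w y) -occ_xy.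
rewrite leqNgt ltnS => /negP; apply; apply: count_take_mono.
rewrite ltn_neqAle yx andbT; apply: contraTneq w_xy => /val_inj->.
by rewrite ltnn.
Qed.

(* The polytabloid of a standard word w is w plus lexicographically larger    *)
(* words.                                                                     *)
Lemma young_coef_lexi v w : v \in standard_words -> w \in standard_words ->
    gcoef c ((reading_perm v)^-1 * reading_perm w)%g != 0 ->
  v = w \/ ((w : seqlexi nat) < v)%O.
Proof.
move=> vW wW /gcoef_young_neq0[s [t [/row_stabilizerP Rs /column_stabilizerP Ct]]].
set qv := reading_perm v; set qw := reading_perm w => e.
have v_t (x : 'I_n) : nth 0%N v x = cell_row p (t^-1%g (qw x)).
  have [<- _] := reading_permP x vW; rewrite -/qv.
  have -> : qw x = t (s (qv x)).
    by rewrite -!permM -e mulKVg.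
  by rewrite permK Rs.
have [x0 tx0|t1] := pickP [pred x : 'I_n | t^-1%g (qw x) != qw x]; last first.
  left; apply: (@eq_from_nth _ 0%N); rewrite !standard_word_size // => x xn.
  have [<- _] := reading_permP (Ordinal xn) wW.
  by rewrite (v_t (Ordinal xn)); have /negbFE/eqP-> := t1 (Ordinal xn).
right; have [x /= tx x_min] := arg_minnP (@nat_of_ord n) tx0.
have t_lt (z : 'I_n) : (z < x)%N -> t^-1%g (qw z) = qw z.
  by move=> zx; apply/eqP; apply: contraTT zx => /x_min; rewrite -leqNgt.
(* [y] is the entry that [w] has in the cell where [v] has [x], up to a row permutation. It is in
   the column of [x], and it exceeds [x] because smaller entries are fixed; so it lies in a lower
   row, and the letter of [v] at [x] is the larger one. *)
pose y := qw^-1%g (t^-1%g (qw x)).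
have qy : qw y = t^-1%g (qw x) by rewrite permKV.
have col_xy : cell_col p (qw x) = cell_col p (qw y).
  by rewrite qy -(Ct (t^-1%g (qw x))) permKV.
have neq_xy : qw y != qw x by rewrite qy.
have xy : (x <= y)%N.
  rewrite leqNgt; apply: contra neq_xy => /t_lt; rewrite qy => /perm_inj ->.
  by rewrite eqxx.
apply: (@lexi_first_difference _ _ x); first by rewrite !standard_word_size.
  move=> z zx; have zn := ltn_trans zx (ltn_ord x).
  by rewrite (v_t (Ordinal zn)) t_lt //; have [-> _] := reading_permP (Ordinal zn) wW.
rewrite v_t -qy; have [-> _] := reading_permP y wW.
case: (ltngtP (nth 0%N w x) (nth 0%N w y)) => // w_xy.
  by have := reading_column_lt wW (esym col_xy) w_xy; rewrite ltnNge xy.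
case/eqP: neq_xy; apply: (@cell_inj _ p) => //.
by have [-> _] := reading_permP x wW; have [-> _] := reading_permP y wW.
Qed.

(** In a linear relation between the polytabloids, take the lexicographically least word that
    occurs. The coefficient of the relation at the inverse of its reading permutation involves no
    other term. *)
Lemma ballot_number_le_rank :
  (ballot_number K n (nth 0%N p) <= \rank (cyclic_mx aG (young_symmetrizer p)))%N.
Proof.
rewrite -size_standard_words; set W := standard_words.
pose q i := reading_perm (nth [::] W i).
pose M := \matrix_(i < size W) gring_row (c *m aG (q i)^-1%g).
have sMU : (M <= cyclic_mx aG (young_symmetrizer p))%MS.
  apply/row_subP => i; rewrite rowK; apply/cyclic_mxP.
  exists (aG (q i)^-1%g); first by rewrite envelop_mx_id ?inE.
  by rewrite gring_row_mul gring_row_young.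
apply: leq_trans (mxrankS sMU); rewrite leq_eqVlt; apply/orP; left.
rewrite eq_sym -/(row_free M) -kermx_eq0; apply/rowV0P => u /sub_kermxP uM.
apply/eqP/rV0Pn => -[i0 ui0].
have [i ui i_min] := @arg_minP _ _ _ i0 (fun i => u 0 i != 0)
  (fun i : 'I_(size W) => nth [::] W i : seqlexi nat) ui0.
have Wi j : nth [::] W (j : 'I_(size W)) \in W by rewrite mem_nth.
have : gcoef (\sum_j u 0 j *: (c *m aG (q j)^-1%g)) (q i)^-1%g = 0.
  rewrite /gcoef linear_sum; have -> : \sum_j gring_row (u 0 j *: (c *m aG (q j)^-1%g)) = u *m M.
    by rewrite mulmx_sum_row; apply: eq_bigr => j _; rewrite rowK linearZ.
  by rewrite uM mxE.
rewrite gcoef_sum (bigD1 i) //= gcoefZ gcoefJr ?young_ring // invgK mulVg gcoef_young1.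
rewrite mulr1 big1 ?addr0 => [ui_eq0|j ji]; first by rewrite ui_eq0 eqxx in ui.
rewrite gcoefZ gcoefJr ?young_ring // invgK; apply/eqP; rewrite mulf_eq0.
apply/norP => -[uj /(young_coef_lexi (Wi i) (Wi j)) [e|lt_ji]].
  case/eqP: ji; apply: val_inj; apply/eqP.
  by rewrite -(nth_uniq [::]  (ltn_ord j) (ltn_ord i) (filter_uniq _ (ballot_words_uniq K n))) e.
by have := i_min j uj; rewrite leNgt lt_ji.
Qed.

Lemma ballot_number_le_specht :
  (ballot_number K n (nth 0%N p))%:R <= specht_char p 1%g.
Proof. by rewrite cfRepr1 ler_nat ballot_number_le_rank. Qed.

End SpechtDegree.

(** * Completeness and Kronecker coefficients *)

Section Completeness.
Variable n : nat.
Local Notation G := [set: 'S_n]%G.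
Implicit Types p : intpart n.

(** With n + 1 letters there is a row for every part of a partition of n, and [sum_ballot_number]
    applies. *)
Definition standard_number p := ballot_number n.+1 n (nth 0%N p).

Lemma factorial_le_sum_standard : (n`! <= \sum_p standard_number p ^ 2)%N.
Proof.
rewrite -(@sum_ballot_number n n) //.
have le_split : (\sum_(w <- ballot_words n.+1 n) ballot_number n.+1 n (content w) <=
    \sum_(w <- ballot_words n.+1 n)
      \sum_(p : intpart n) eq_shape n.+1 (content w) (nth 0 p) * standard_number p)%N.
  rewrite big_seq [X in (_ <= X)%N]big_seq; apply: leq_sum => w w_ballot.
  have [l l_part lw] := ballot_word_shape w_ballot.
  rewrite (bigD1 (IntPart l_part)) //= (introT (eq_shapeP _ _ _)); last first.
    by move=> i iK; rewrite lw.
  rewrite mul1n; apply: leq_trans (leq_addr _ _).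
  by rewrite /standard_number (@eq_ballot_number _ _ _ (nth 0%N l)) // => i /lw.
apply: leq_trans le_split _; rewrite exchange_big /= leq_sum // => p _.
rewrite -big_distrl /= -mulnn leq_mul2r; apply/orP; right.
by rewrite /standard_number /ballot_number -sum1_count [X in (_ <= X)%N]big_mkcond.
Qed.

Definition specht_index p : Iirr G := cfIirr (specht_char p).

Lemma specht_indexE p : 'chi_(specht_index p) = specht_char p.
Proof. by rewrite cfIirrE ?specht_irr. Qed.

Lemma specht_index_inj : injective specht_index.
Proof.
by move=> p q /(congr1 (fun i => 'chi_i)); rewrite !specht_indexE => /specht_inj.
Qed.

Lemma standard_number_le_specht p : (standard_number p)%:R <= specht_char p 1%g.
Proof.
apply: ballot_number_le_specht; exact: leq_trans (size_intpart p) (leqnSn n).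
Qed.

(** The squares of all irreducible degrees add up to n!, and at least n! is subtracted. Since every
    term on the left is nonnegative, all vanish: this gives at once the degrees and the absence of
    other irreducible characters. *)
Lemma sum_specht_defect :
  \sum_q (specht_char q 1%g ^+ 2 - (standard_number q)%:R ^+ 2) +
  \sum_(i | i \notin specht_index @: setT) 'chi[G]_i 1%g ^+ 2 <= 0.
Proof.
have -> : \sum_q (specht_char q 1%g ^+ 2 - (standard_number q)%:R ^+ 2) =
    \sum_(i in specht_index @: setT) 'chi_i 1%g ^+ 2 - (\sum_q standard_number q ^ 2)%:R.
  rewrite sumrB big_imset /=; last by move=> p q _ _; apply: specht_index_inj.
  rewrite natr_sum; congr (_ - _); last by apply: eq_bigr => q _; rewrite natrX.
  by apply: eq_big => [q|q _]; rewrite ?inE ?specht_indexE.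
have eG : \sum_(i in specht_index @: setT) 'chi[G]_i 1%g ^+ 2 +
    \sum_(i | i \notin specht_index @: setT) 'chi[G]_i 1%g ^+ 2 = #|G|%:R.
  by rewrite -irr_sum_square [RHS](bigID (mem (specht_index @: setT))).
rewrite addrAC eG subr_le0 ler_nat /=.
by rewrite cardsT card_Sn factorial_le_sum_standard.
Qed.

Lemma specht_defect_ge0 q : 0 <= specht_char q 1%g ^+ 2 - (standard_number q)%:R ^+ 2.
Proof.
rewrite subr_ge0 lerXn2r ?standard_number_le_specht // nnegrE ?ler0n //.
by rewrite char1_ge0 ?cfRepr_char.
Qed.

Lemma irr_square_ge0 (i : Iirr G) : 0 <= 'chi_i 1%g ^+ 2.
Proof. by rewrite exprn_ge0 // ltW // irr1_gt0. Qed.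

Lemma specht_degree p : specht_char p 1%g = (standard_number p)%:R.
Proof.
have ge0 : 0 <= \sum_(i | i \notin specht_index @: setT) 'chi[G]_i 1%g ^+ 2.
  by apply: sumr_ge0 => i _; apply: irr_square_ge0.
have /eqP : \sum_q (specht_char q 1%g ^+ 2 - (standard_number q)%:R ^+ 2) = 0.
  apply/eqP; rewrite eq_le sumr_ge0 ?andbT => [|q _]; last exact: specht_defect_ge0.
  by apply: le_trans sum_specht_defect; rewrite lerDl.
rewrite psumr_eq0 => [/allP/(_ p (mem_index_enum p))/=|q _]; last exact: specht_defect_ge0.
rewrite subr_eq0 eqrXn2 // ?char1_ge0 ?cfRepr_char // => /eqP //.
Qed.

Lemma irr_specht (i : Iirr G) : exists p, 'chi_i = specht_char p.
Proof.
suff /imsetP[p _ ->] : i \in specht_index @: setT by exists p; rewrite specht_indexE.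
apply/negPn/negP => i_notin; suff gt0 : 0 <
    \sum_q (specht_char q 1%g ^+ 2 - (standard_number q)%:R ^+ 2) +
    \sum_(i | i \notin specht_index @: setT) 'chi[G]_i 1%g ^+ 2.
  by have := lt_le_trans gt0 sum_specht_defect; rewrite ltxx.
apply: ltr_wpDl; first by apply: sumr_ge0 => q _; apply: specht_defect_ge0.
rewrite (bigD1 i) //= ltr_wpDr ?exprn_gt0 ?irr1_gt0 //.
by apply: sumr_ge0 => j _; apply: irr_square_ge0.
Qed.

Lemma specht_orthonormal p q : '[specht_char p, specht_char q] = (p == q)%:R.
Proof.
by rewrite -!specht_indexE cfdot_irr (inj_eq specht_index_inj).
Qed.

Let spechts := [tuple specht_char (enum_val i) | i < #|{: intpart n}|].

Lemma specht_free : free spechts.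
Proof.
apply/orthonormal_free/orthonormalP; split=> [|phi psi].
  rewrite map_inj_uniq ?enum_uniq // => i j /specht_inj/enum_val_inj //.
case/mapP => i _ -> /mapP[j _ ->]; rewrite specht_orthonormal.
by congr (nat_of_bool _)%:R; apply/eqP/eqP => [->|/specht_inj].
Qed.

Lemma specht_expansion (chi : 'CF(G)) :
  chi = \sum_p '[chi, specht_char p] *: specht_char p.
Proof.
rewrite {1}(cfun_sum_cfdot chi) (reindex specht_index) /=.
  by apply: eq_bigr => p _; rewrite specht_indexE.
apply: onW_bij; apply: inj_card_bij; first exact: specht_index_inj.
have surj : codom specht_index =i predT.
  move=> i; rewrite inE; apply/codomP; have [p eq_p] := irr_specht i.
  by exists p; apply: irr_inj; rewrite specht_indexE.
by rewrite -(eq_card surj) card_codom //; apply: specht_index_inj.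
Qed.

(** By orthonormality the coordinate is an inner product of characters, hence a natural number, on
    which [Num.truncn] is exact. *)
Lemma kronecker_multE (la mu nu : intpart n) :
  (kronecker_mult la mu nu)%:R = '[specht_char la * specht_char mu, specht_char nu].
Proof.
set phi := specht_char la * specht_char mu.
have coord_specht p : coord spechts (enum_rank nu) (specht_char p) = (nu == p)%:R.
  have -> : specht_char p = spechts`_(enum_rank p).
    by rewrite -tnth_nth tnth_mktuple enum_rankK.
  by rewrite coord_free ?specht_free // (inj_eq enum_rank_inj) eq_sym.
have -> : kronecker_mult la mu nu = Num.truncn '[phi, specht_char nu].
  rewrite /kronecker_mult -/spechts -/phi {1}(specht_expansion phi).
  rewrite linear_sum (bigD1 nu) //= linearZ /= coord_specht eqxx mulr1 big1 ?addr0 // => p p_nu.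
  by rewrite linearZ /= coord_specht eq_sym (negPf p_nu) mulr0.
apply/eqP; rewrite -natrEtruncn Cnat_cfdot_char ?cfRepr_char //.
by rewrite rpredM ?cfRepr_char.
Qed.

Lemma kronecker_degree (la mu : intpart n) :
  (standard_number la * standard_number mu)%N =
  (\sum_nu kronecker_mult la mu nu * standard_number nu)%N.
Proof.
apply/eqP; rewrite -eqC_nat natrM -!specht_degree natr_sum; apply/eqP.
transitivity ((specht_char la * specht_char mu) 1%g); first by rewrite [RHS]cfunE.
rewrite {1}(specht_expansion (specht_char la * specht_char mu)) sum_cfunE.
by apply: eq_bigr => nu _; rewrite cfunE natrM kronecker_multE specht_degree.
Qed.

End Completeness.

(** * Constituents of a Kronecker product have few rows *)

Section RowBound.
Variables (n : nat) (la mu nu : intpart n).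
Local Notation G := [set: 'S_n]%G.

Definition tabloid_char (p : intpart n) : 'CF(G) :=
  'Ind[G] (1 : 'CF(row_stabilizer_group p)).

Lemma tabloid_char_char p : tabloid_char p \is a character.
Proof. by rewrite cfInd_char ?rpred1. Qed.

Lemma specht_le_tabloid p : exists2 chi, chi \is a character &
  tabloid_char p = specht_char p + chi.
Proof.
rewrite -specht_indexE; apply/constt_charP; first exact: tabloid_char_char.
rewrite irr_consttE specht_indexE -Frobenius_reciprocity cfdotC fmorph_eq0.
exact: specht_row_constt.
Qed.

Hypothesis many_rows : (size la * size mu < size nu)%N.

(** Pigeonhole on the first column of [nu], whose cells outnumber the pairs of rows. *)
Lemma first_column_collision (g h : 'S_n) : exists x y : 'I_n,
  [/\ x != y, cell_col nu x = cell_col nu y,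
      cell_row la (g x) = cell_row la (g y) & cell_row mu (h x) = cell_row mu (h y)].
Proof.
pose f (i : 'I_(size nu)) := s2val (cell_exists (intpart_nth_gt0 (ltn_ord i))).
have fr i : cell_row nu (f i) = i by rewrite /f; case: cell_exists.
have fc i : cell_col nu (f i) = 0%N by rewrite /f; case: cell_exists.
pose F i := (Ordinal (cell_row_lt la (g (f i))), Ordinal (cell_row_lt mu (h (f i)))).
have /injectivePn[i [j ij [eq_la eq_mu]]] : ~~ injectiveb F.
  apply: contraTN many_rows => /injectiveP/card_codom F_card.
  rewrite -leqNgt -[X in (X <= _)%N]card_ord -F_card.
  by rewrite (leq_trans (max_card _)) // card_prod !card_ord.
exists (f i), (f j); split; rewrite ?fc //.
by apply: contra_neq ij => /(congr1 (@cell_row _ nu)); rewrite !fr => /val_inj.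
Qed.

(** Expanding both induced characters leaves, for each pair (g, h), a sum of signs over the column
    permutations s with [s ^ g] and [s ^ h] in the two row groups. The transposition of a colliding
    pair cancels it. *)
Lemma tabloid_product_sign :
  '['Res[column_stabilizer_group nu] (tabloid_char la * tabloid_char mu),
    sign_char (column_stabilizer_group nu)] = 0.
Proof.
rewrite cfdotE; set S := (X in _ * X); suff -> : S = 0 by rewrite mulr0.
rewrite {}/S; under eq_bigr => x Cx.
  rewrite cfResE ?subsetT // cfunE !cfIndE ?subsetT // mulrACA.
  rewrite big_distrlr /= -!mulrA big_distrl /=; over.
rewrite -2!mulr_sumr exchange_big /= big1 ?mulr0 // => g _.
under eq_bigr do rewrite mulr_suml; rewrite exchange_big big1 //= => h _.
have [x [y [xy cxy rg rh]]] := first_column_collision g h.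
have Ct := tperm_column_stabilizer cxy.
under eq_bigr => s Cs.
  rewrite !cfun1E sign_charE Cs rmorph_sign -natrM mulnb mulr_natl mulrb; over.
rewrite -big_mkcondr; apply: (sign_sum_eq0 (t := tperm x y) Ct) => [|s _].
  by rewrite odd_tperm.
by rewrite !conjMg !tpermJ (groupMr _ (tperm_row_stabilizer rg))
  (groupMr _ (tperm_row_stabilizer rh)).
Qed.

(** A constituent [nu] would carry the sign of its column group into the product of the Specht
    characters, and from there into the larger product of tabloid characters, where it does not
    occur. *)
Lemma kronecker_mult_eq0 : kronecker_mult la mu nu = 0%N.
Proof.
apply/eqP; rewrite -eqC_nat kronecker_multE; apply/negPn/negP => kappa.
have [al char_al def_la] := specht_le_tabloid la.
have [be char_be def_mu] := specht_le_tabloid mu.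
have [ga char_ga def_nu] : exists2 ga, ga \is a character &
    specht_char la * specht_char mu = specht_char nu + ga.
  rewrite -(specht_indexE nu); apply/constt_charP; first by rewrite rpredM ?cfRepr_char.
  by rewrite irr_consttE specht_indexE.
have := tabloid_product_sign.
rewrite def_la def_mu mulrDl mulrDr def_nu -2!addrA.
set de := ga + _; have char_de : de \is a character.
  by rewrite /de; do ?[apply: rpredD | apply: rpredM]; rewrite ?cfRepr_char //; apply: char_ga.
rewrite linearD cfdotDl /= => sum0.
have ge0 (phi : 'CF(G)) : phi \is a character ->
    0 <= '['Res phi, sign_char (column_stabilizer_group nu)].
  move=> char_phi; have char_Res := cfRes_char (column_stabilizer_group nu) char_phi.
  have char_sign := lin_charW (sign_char_lin (column_stabilizer_group nu)).
  exact: natr_ge0 (Cnat_cfdot_char char_Res char_sign).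
have gt0 : 0 < '['Res (specht_char nu), sign_char (column_stabilizer_group nu)].
  rewrite lt_neqAle eq_sym (ge0 _ (cfRepr_char _)) andbT.
  exact: specht_column_constt (subxx _).
by have := ltr_wpDr (ge0 de char_de) gt0; rewrite sum0 ltxx.
Qed.

End RowBound.

(** * The degree formula *)

Section RowReplacement.
Variables (F : comNzRingType) (K : nat).

Definition replace_row (A : 'M[F]_K) i (r : 'rV[F]_K) : 'M[F]_K :=
  \matrix_(a, j) if a == i then r 0 j else A a j.

Lemma minor_replace_row A i j r : row' i (col' j (replace_row A i r)) = row' i (col' j A).
Proof.
by apply/matrixP => a b; rewrite !mxE eq_sym (negPf (neq_lift _ _)).
Qed.

(** Jacobi's formula: both sides are the derivative of the determinant at [A] in the direction
    [B]. *)
Lemma sum_det_replace_row (A B : 'M[F]_K) :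
  \sum_i \det (replace_row A i (row i B)) = \tr (B *m \adj A).
Proof.
apply: eq_bigr => i _; rewrite (expand_det_row _ i) mxE; apply: eq_bigr => j _.
by rewrite !mxE eqxx /cofactor minor_replace_row.
Qed.

Lemma det_replace_row_scale (A : 'M[F]_K) i a (r : 'rV[F]_K) :
  \det (replace_row A i (a *: r)) = a * \det (replace_row A i r).
Proof.
rewrite !(expand_det_row _ i) mulr_sumr; apply: eq_bigr => j _.
by rewrite !mxE eqxx -mulrA /cofactor !minor_replace_row.
Qed.

End RowReplacement.

(** * Adding and removing a unit in the Vandermonde determinant *)

Section Vandermonde.
Variables (F : comNzRingType) (K : nat).
Implicit Types (l : {ffun 'I_K -> nat}) (i j : 'I_K).

Definition add_unit l i : {ffun 'I_K -> nat} := [ffun x => (l x + (x == i))%N].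
Definition del_unit l i : {ffun 'I_K -> nat} := [ffun x => (l x - (x == i))%N].

Definition ffact_mx l : 'M[F]_K := \matrix_(i, j) (l i ^_ (K.-1 - j))%:R.

(* The Vandermonde determinant of l, up to sign, in the basis of falling      *)
(* factorials, in which shifting a variable by one acts linearly.             *)
Definition vdm l : F := \det (ffact_mx l).

Lemma vdm_eq0 l i j : i != j -> l i = l j -> vdm l = 0.
Proof.
move=> ij lij; apply: (determinant_alternate ij) => a.
by rewrite !mxE lij.
Qed.

Lemma ffact_mx_update l l' i : (forall x, x != i -> l' x = l x) ->
  ffact_mx l' = replace_row (ffact_mx l) i (row i (ffact_mx l')).
Proof.
move=> ll'; apply/matrixP => a j; rewrite !mxE.
by case: (eqVneq a i) => [->|/ll' ->].
Qed.

Lemma ffactSE n m : (n.+1 ^_ m)%N = (n ^_ m + m * n ^_ m.-1)%N.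
Proof.
case: m => [|m]; first by rewrite !ffactn0.
rewrite ffactSS ffactnSr /=; have [mn|nm] := leqP m n; last by rewrite ffact_small ?muln0.
by rewrite [(_ * (n - m))%N]mulnC -mulnDl; congr (_ * _)%N; lia.
Qed.

(** Harmonicity of V. The Pascal-type rule [ffactSE] makes the shifted row a row of [A + A *m N],
    where [N] has zero diagonal; in Jacobi's formula only the trace of [1 + N], which is K,
    survives. *)
Lemma sum_vdm_add l : \sum_i vdm (add_unit l i) = K%:R * vdm l.
Proof.
pose N : 'M[F]_K := \matrix_(a, j) ((K.-1 - j)%:R *+ (a == j.+1 :> nat)).
set A := ffact_mx l.
have rowE i : row i (ffact_mx (add_unit l i)) = row i (A + A *m N).
  apply/rowP => j; rewrite !mxE ffunE eqxx addn1 ffactSE natrD; congr (_ + _).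
  have [jK|Kj] := ltnP j.+1 K; last first.
    have -> : (K.-1 - j = 0)%N by lia.
    by rewrite mul0n big1 // => a _; rewrite !mxE ltn_eqF ?mulr0 // (leq_trans (ltn_ord a)).
  rewrite (bigD1 (Ordinal jK)) //= !mxE eqxx mulr1n big1 ?addr0 => [|a aj].
    by rewrite natrM mulrC subnS /=.
  rewrite !mxE (_ : (_ == _) = false) ?mulr0 //; apply: negPf.
  by apply: contraNN aj => /eqP ?; apply/eqP/val_inj.
transitivity (\sum_i \det (replace_row A i (row i (A + A *m N)))).
  apply: eq_bigr => i _; rewrite -rowE /vdm; congr (\det _).
  apply: ffact_mx_update => x xi; by rewrite ffunE (negPf xi) addn0.
rewrite sum_det_replace_row mulmxDl mxtraceD mul_mx_adj mxtrace_scalar mulr_natl.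
rewrite -[X in _ + X]mxtrace_mulC mulmxA mul_adj_mx mul_scalar_mx mxtraceZ.
rewrite [\tr N]big1 ?mulr0 ?addr0 // => i _; rewrite mxE.
by rewrite ltn_eqF.
Qed.

(** Here x times the falling factorial of x - 1 of order d is x - d times that of x of order d, so
    the new rows are those of [diag_mx X *m A - A *m diag_mx D]. The traces of the two diagonal
    matrices give the eigenvalue. *)
Lemma sum_vdm_del l : \sum_i (l i)%:R * vdm (del_unit l i) =
  ((\sum_i l i)%:R - 'C(K, 2)%:R) * vdm l.
Proof.
set A := ffact_mx l.
pose X : 'rV[F]_K := \row_i (l i)%:R; pose D : 'rV[F]_K := \row_j (K.-1 - j)%:R.
pose B := diag_mx X *m A - A *m diag_mx D.
have rowE i : (l i)%:R *: row i (ffact_mx (del_unit l i)) = row i B.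
  apply/rowP => j; rewrite /B mul_diag_mx mul_mx_diag !mxE ffunE eqxx subn1.
  rewrite -natrM [_ * (_ - _)%:R]mulrC -mulrBl.
  case: (l i) => [|m] /=.
    rewrite mul0n sub0r; case: (K.-1 - j)%N => [|d]; first by rewrite mulNr mul0r oppr0.
    by rewrite ffact0n mulr0.
  rewrite -ffactSS ffactnSr natrM; have [dm|md] := leqP (K.-1 - j) m.+1.
    by rewrite natrB // mulrC.
  by rewrite ffact_small // mul0r mulr0.
transitivity (\sum_i \det (replace_row A i (row i B))).
  apply: eq_bigr => i _; rewrite -rowE det_replace_row_scale; congr (_ * _).
  rewrite /vdm; congr (\det _); apply: ffact_mx_update => x xi.
  by rewrite ffunE (negPf xi) subn0.
rewrite sum_det_replace_row mulmxBl linearB /= -mulmxA mul_mx_adj mul_mx_scalar linearZ.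
rewrite mxtrace_mulC mulmxA mul_adj_mx mul_scalar_mx linearZ /= !mxtrace_diag.
rewrite mulrBl ![\det A * _]mulrC natr_sum; congr (_ * _ - _ * _).
  by apply: eq_bigr => i _; rewrite mxE.
rewrite -bin2_sum natr_sum big_mkord (reindex_inj rev_ord_inj) /=.
apply: eq_bigr => i _; rewrite mxE /=; congr _%:R.
have := ltn_ord i; lia.
Qed.

End Vandermonde.

Section DegreeFormula.
Variables (F : comNzRingType) (K : nat).

Definition stagger (f : nat -> nat) : {ffun 'I_K -> nat} := [ffun i : 'I_K => (f i + (K.-1 - i))%N].

Lemma sum_stagger f : (\sum_i stagger f i = \sum_(i < K) f i + 'C(K, 2))%N.
Proof.
under eq_bigr do rewrite ffunE; rewrite big_split /=; congr (_ + _)%N.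
rewrite -bin2_sum big_mkord [RHS](reindex_inj rev_ord_inj) /=.
by apply: eq_bigr => i _; have := ltn_ord i; lia.
Qed.

Lemma vdm_stagger0 f : (forall i, (i < K)%N -> f i = 0%N) ->
  vdm F (stagger f) = \prod_i ((stagger f i)`!)%:R.
Proof.
move=> f0; rewrite /vdm -det_tr det_trig.
  by apply: eq_bigr => i _; rewrite !mxE ffunE f0 // add0n ffactnn.
apply/is_trig_mxP => i j ij; rewrite !mxE ffunE f0 // add0n ffact_small //.
by have := ltn_ord j; lia.
Qed.

Lemma stagger_del (f : nat -> nat) (i : 'I_K) : (0 < f i)%N ->
  stagger (del_box f i) = del_unit (stagger f) i.
Proof.
move=> fi; apply/ffunP => x; rewrite !ffunE /del_box.
by case: (eqVneq x i) => [->|xi]; rewrite ?eqxx ?(inj_eq val_inj) ?(negPf xi); lia.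
Qed.

(* Removing a box that does not leave a partition creates two equal entries   *)
(* (or a negative last one), so that such terms vanish on the right.          *)
Lemma vdm_del_eq0 (f : nat -> nat) (i : 'I_K) : decreasing K f ->
    ~~ ((0 < f i)%N && decreasing K (del_box f i)) ->
  (stagger f i)%:R * vdm F (del_unit (stagger f) i) = 0.
Proof.
move=> /decreasingP dec_f not_rem; have iK := ltn_ord i.
have [i1K|Ki1] := ltnP i.+1 K; last first.
  have fi0 : f i = 0%N.
    apply/eqP; rewrite -leqn0 leqNgt; apply: contra not_rem => fi; rewrite fi.
    apply/decreasingP => x xK; have := dec_f x xK; rewrite /del_box; lia.
  by rewrite ffunE fi0 (_ : (K.-1 - i = 0)%N) ?mul0r //; lia.
have fi1 : f i.+1 = f i.
  apply/eqP; rewrite eqn_leq dec_f //= leqNgt; apply: contra not_rem => fi.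
  apply/andP; split; first exact: leq_trans fi.
  apply/decreasingP => x xK; have := dec_f x xK; rewrite /del_box.
  by case: (eqVneq x i) => [->|]; lia.
rewrite (@vdm_eq0 _ _ _ i (Ordinal i1K)) ?mulr0 //; first by rewrite -val_eqE /= neq_ltn leqnn.
rewrite !ffunE eqxx /= fi1 -val_eqE /=; lia.
Qed.

(** Both sides satisfy the box-removal recursion, since the eigenvalue in [sum_vdm_del] is the
    number of boxes. Denominators are cleared so that the identity is also available over [int]. *)
Lemma ballot_number_vdm n f : decreasing K f -> (\sum_(i < K) f i = n)%N ->
  (ballot_number K n f)%:R * \prod_i ((stagger f i)`!)%:R = n`!%:R * vdm F (stagger f).
Proof.
elim: n f => [|n IHn] f dec_f sum_f.
  have f0 i : (i < K)%N -> f i = 0%N.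
    by move=> iK; move/eqP: sum_f; rewrite sum_nat_eq0 => /forallP/(_ (Ordinal iK))/eqP.
  rewrite vdm_stagger0 // ballot_number0 (introT (eq_shapeP _ _ _)) // => i iK.
  by rewrite f0.
rewrite ballot_numberS // natr_sum big_distrl /= factS natrM mulrAC.
have -> : n.+1%:R * vdm F (stagger f) = \sum_i (stagger f i)%:R * vdm F (del_unit (stagger f) i).
  by rewrite sum_vdm_del sum_stagger sum_f natrD addrK.
rewrite mulrC mulr_sumr big_mkcond; apply: eq_bigr => i _; case: ifP => fi; last first.
  by rewrite (@vdm_del_eq0 f) ?fi ?mulr0.
case dec_fi : (decreasing K (del_box f i)); last first.
  by rewrite ballot_number_not_decreasing ?dec_fi // mul0r vdm_del_eq0 ?fi ?dec_fi ?mulr0.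
have sum_fi : (\sum_(j < K) del_box f i j = n)%N.
  have := sum_f; rewrite (bigD1 i) //= [in X in _ -> X](bigD1 i) //=.
  under [X in _ -> (_ + X = _)%N]eq_bigr => j ji.
    rewrite /del_box (inj_eq val_inj) (negPf ji) subn0; over.
  by rewrite /del_box eqxx; lia.
rewrite [RHS]mulrCA -stagger_del // -IHn // mulrCA; congr (_ * _).
rewrite (bigD1 i) //= [in RHS](bigD1 i) //= mulrA; congr (_ * _).
  rewrite -natrM !ffunE /del_box eqxx; congr _%:R.
  by rewrite -[f i in LHS](subnK fi) addn1 addSn factS -addSn -addn1 subnK.
by apply: eq_bigr => j ji; rewrite stagger_del // [del_unit _ _ _]ffunE (negPf ji) subn0.
Qed.

End DegreeFormula.

(** * Sums of degrees *)

Section WordSums.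
Variables (F : realFieldType) (K : nat).
Implicit Types (l : {ffun 'I_K -> nat}) (g h : {ffun 'I_K -> nat} -> F).

(* The sum of g over the contents of the words of length N in K letters.      *)
Fixpoint word_sum N g : F :=
  if N is M.+1 then \sum_i word_sum M (fun l => g (add_unit l i)) else g [ffun=> 0%N].

Lemma sum_add_unit l i : (\sum_x add_unit l i x = (\sum_x l x).+1)%N.
Proof.
under eq_bigr do rewrite ffunE; rewrite big_split /= -addn1; congr (_ + _)%N.
by rewrite (bigD1 i) //= eqxx big1 // => x /negPf->.
Qed.

Lemma add_unitAC l i j : add_unit (add_unit l i) j = add_unit (add_unit l j) i.
Proof. by apply/ffunP => x; rewrite !ffunE addnAC. Qed.

Lemma ler_word_sum N g h : (forall l, (\sum_x l x = N)%N -> g l <= h l) ->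
  word_sum N g <= word_sum N h.
Proof.
elim: N g h => [|N IHN] g h gh /=.
  by apply: gh; rewrite big1 // => x _; rewrite ffunE.
apply: ler_sum => i _; apply: IHN => l lN; apply: gh.
by rewrite sum_add_unit lN.
Qed.

Lemma eq_word_sum N g h : (forall l, (\sum_x l x = N)%N -> g l = h l) ->
  word_sum N g = word_sum N h.
Proof.
by move=> gh; apply/eqP; rewrite eq_le !ler_word_sum // => l /gh ->.
Qed.

Lemma word_sumZ N a g : word_sum N (fun l => a * g l) = a * word_sum N g.
Proof.
elim: N g => [|N IHN] g //=; rewrite mulr_sumr.
by apply: eq_bigr => i _; rewrite -IHN.
Qed.

Lemma word_sumD N g h : word_sum N (fun l => g l + h l) = word_sum N g + word_sum N h.
Proof.
elim: N g h => [|N IHN] g h //=; rewrite -big_split.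
by apply: eq_bigr => i _; apply: IHN.
Qed.

Lemma word_sum_sum (I : Type) (r : seq I) (P : pred I) N (g : I -> {ffun 'I_K -> nat} -> F) :
  word_sum N (fun l => \sum_(i <- r | P i) g i l) = \sum_(i <- r | P i) word_sum N (g i).
Proof.
elim: N g => [|N IHN] g //=; rewrite exchange_big /=.
by apply: eq_bigr => i _; rewrite -IHN.
Qed.

Lemma word_sum_cst N a : word_sum N (fun=> a) = K%:R ^+ N * a.
Proof.
elim: N => [|N IHN] /=; first by rewrite mul1r.
by rewrite IHN sumr_const card_ord exprS -mulrA mulr_natl.
Qed.

(** Deleting a marked letter i from a word of length N + 1 leaves a word of length N and one of N +
    1 positions. This is the adjointness of adding and deleting a letter. *)
Lemma word_sum_coord N i h :
  word_sum N.+1 (fun l => (l i)%:R * h l) = N.+1%:R * word_sum N (fun l => h (add_unit l i)).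
Proof.
elim: N h => [|N IHN] h.
  rewrite /= (bigD1 i) //= !ffunE eqxx add0n big1 ?addr0 // => j ji.
  by rewrite !ffunE eq_sym (negPf ji) add0n mul0r.
rewrite [LHS]/=; under eq_bigr => j _.
  rewrite -/(word_sum N.+1 (fun l => (add_unit l j i)%:R * h (add_unit l j))).
  rewrite (@eq_word_sum _ _ (fun l =>
    (l i)%:R * h (add_unit l j) + (i == j)%:R * h (add_unit l j))); last first.
    by move=> l _; rewrite ffunE natrD mulrDl.
  rewrite word_sumD (IHN (fun l => h (add_unit l j))) word_sumZ; over.
rewrite big_split /= -mulr_sumr [X in _ + X](bigD1 i) //= eqxx mul1r.
rewrite [X in _ + (_ + X)]big1 ?addr0; last first.
  by move=> j ji; rewrite eq_sym (negPf ji) mul0r.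
have -> : \sum_j word_sum N (fun l => h (add_unit (add_unit l i) j)) =
    word_sum N.+1 (fun l => h (add_unit l i)).
  by apply: eq_bigr => j _; apply: eq_word_sum => l _; rewrite add_unitAC.
by rewrite -[X in _ + X]mul1r -mulrDl natr1.
Qed.

Definition vdm_moment N := word_sum N (fun l => vdm F l ^+ 2).

(** Write one factor V by [sum_vdm_del], move the deletion onto the other factor by adjointness, and
    apply harmonicity there. *)
Lemma vdm_momentS N : (N.+1%:R - 'C(K, 2)%:R) * vdm_moment N.+1 = N.+1%:R * K%:R * vdm_moment N.
Proof.
rewrite /vdm_moment -[LHS]word_sumZ.
transitivity (word_sum N.+1 (fun l => \sum_i (l i)%:R * (vdm F (del_unit l i) * vdm F l))).
  apply: eq_word_sum => l lN; under eq_bigr do rewrite mulrA.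
  by rewrite -mulr_suml sum_vdm_del lN expr2 mulrA.
rewrite word_sum_sum; under eq_bigr do rewrite word_sum_coord.
rewrite -mulr_sumr -word_sum_sum -mulrA; congr (_ * _); rewrite -word_sumZ.
apply: eq_word_sum => l _; rewrite expr2 mulrA -sum_vdm_add mulr_suml.
apply: eq_bigr => i _; rewrite mulrC; congr (_ * vdm F _).
by apply/ffunP => x; rewrite !ffunE addnK.
Qed.

(** The recursion degenerates at length P, where its left coefficient vanishes; the moment at that
    length stays as a constant. *)
Lemma vdm_momentE d : vdm_moment ('C(K, 2) + d) =
  K%:R ^+ d * 'C('C(K, 2) + d, d)%:R * vdm_moment 'C(K, 2).
Proof.
elim: d => [|d IHd]; first by rewrite addn0 bin0 !mul1r.
set P := 'C(K, 2) in IHd *.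
have d0 : d.+1%:R != 0 :> F by rewrite pnatr_eq0.
apply: (mulfI d0); have := vdm_momentS (P + d); rewrite -/P.
have -> : (P + d).+1%:R - P%:R = d.+1%:R :> F by rewrite -addnS natrD addrAC subrr add0r.
rewrite addnS => ->; rewrite IHd exprS.
have e : (P + d).+1%:R * 'C(P + d, d)%:R = d.+1%:R * 'C((P + d).+1, d.+1)%:R :> F.
  by rewrite -!natrM -mul_bin_diag.
transitivity ((P + d).+1%:R * 'C(P + d, d)%:R * (K%:R * K%:R ^+ d * vdm_moment P)); first by ring.
by rewrite e; ring.
Qed.

Lemma word_sum_eq N l0 : (\sum_x l0 x = N)%N ->
  word_sum N (fun l => (l == l0)%:R) * \prod_x ((l0 x)`!)%:R = N`!%:R.
Proof.
elim: N l0 => [|N IHN] l0 sum_l0 /=.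
  have l00 x : l0 x = 0%N.
    by move/eqP: sum_l0; rewrite sum_nat_eq0 => /forallP/(_ x)/eqP.
  rewrite (_ : _ == _) ?mul1r; last by apply/eqP/ffunP => x; rewrite ffunE l00.
  by rewrite big1 // => x _; rewrite l00.
rewrite mulr_suml factS natrM -{1}sum_l0 natr_sum mulr_suml; apply: eq_bigr => i _.
case: (posnP (l0 i)) => [l0i|l0i].
  rewrite (@eq_word_sum _ _ (fun=> 0)) ?word_sum_cst ?mulr0 ?l0i ?mul0r // => l _.
  by case: eqP => // /ffunP/(_ i); rewrite ffunE eqxx l0i addn1.
rewrite (@eq_word_sum _ _ (fun l => (l == del_unit l0 i)%:R)); last first.
  move=> l _; congr (nat_of_bool _)%:R; apply/eqP/eqP => [<-|->];
    apply/ffunP => x; rewrite !ffunE ?addnK //.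
  by rewrite subnK //; case: eqP => // ->.
rewrite -(IHN (del_unit l0 i)); last first.
  apply: succn_inj; rewrite -sum_l0 -(sum_add_unit _ i); apply: eq_bigr => x _.
  by rewrite !ffunE subnK //; case: eqP => // ->.
rewrite mulrCA; congr (_ * _).
rewrite (bigD1 i) //= [in RHS](bigD1 i) //= mulrA; congr (_ * _).
  by rewrite ffunE eqxx subn1 -natrM -{1 2}(prednK l0i) factS.
by apply: eq_bigr => x xi; rewrite ffunE (negPf xi) subn0.
Qed.

End WordSums.

Section SumOfDegrees.
Variables (F : realFieldType) (n K : nat).
Hypothesis K_gt0 : (0 < K)%N.
Implicit Types nu mu : intpart n.

Lemma standard_number_rows nu : (size nu <= K)%N ->
  standard_number nu = ballot_number K n (nth 0%N nu).
Proof.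
move=> nuK; have nu0 m i : (size nu <= m)%N -> (m <= i)%N -> nth 0%N nu i = 0%N.
  by move=> num mi; rewrite nth_default // (leq_trans num).
rewrite /standard_number -(@ballot_number_widen n.+1 (maxn n.+1 K)) ?leq_maxl //.
  by rewrite -(@ballot_number_widen K (maxn n.+1 K)) ?leq_maxr // => i; apply: nu0.
by move=> i; apply: nu0; apply: leq_trans (size_intpart nu) _.
Qed.

Lemma decreasing_intpart nu : decreasing K (nth 0%N nu).
Proof. by apply/decreasingP => i _; apply: nth_intpart_le. Qed.

Lemma sum_intpart_rows nu : (size nu <= K)%N -> (\sum_(i < K) nth 0 nu i = n)%N.
Proof.
move=> nuK; rewrite -[RHS](sumn_intpart nu) sumnE (big_nth 0%N) big_mkord.
rewrite (big_ord_widen K (nth 0%N nu) nuK) [RHS]big_mkcond; apply: eq_bigr => i _.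
by case: ltnP => // /(nth_default 0%N)->.
Qed.

Lemma stagger_intpart_inj nu mu : (size nu <= K)%N -> (size mu <= K)%N ->
  stagger K (nth 0%N nu) = stagger K (nth 0%N mu) -> nu = mu.
Proof.
move=> nuK muK /ffunP eq_st; apply: intpart_eq => i.
have [iK|Ki] := ltnP i K; last by rewrite !nth_default // (leq_trans _ Ki).
by have := eq_st (Ordinal iK); rewrite !ffunE => /addIn.
Qed.

Let shape nu := stagger K (nth 0%N nu).
Let N := (n + 'C(K, 2))%N.
(** The multinomial coefficient of the staggered shape, as a number of words. *)
Let mass nu : F := word_sum N (fun l => (l == shape nu)%:R).

Lemma standard_number_vdm nu : (size nu <= K)%N ->
  N`!%:R * (standard_number nu)%:R = n`!%:R * (mass nu * vdm F (shape nu)).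
Proof.
move=> nuK; have fact_neq0 : \prod_i ((shape nu i)`!)%:R != 0 :> F.
  by apply/prodf_neq0 => i _; rewrite pnatr_eq0 -lt0n fact_gt0.
apply: (mulIf fact_neq0); rewrite standard_number_rows // -mulrA.
rewrite (ballot_number_vdm F (decreasing_intpart nu) (sum_intpart_rows nuK)).
rewrite -(@word_sum_eq F K N (shape nu)); last by rewrite sum_stagger sum_intpart_rows.
by rewrite -/(mass nu) -/(shape nu); ring.
Qed.

Lemma mass_ge0 nu : 0 <= mass nu.
Proof.
rewrite -(mulr0 (K%:R ^+ N)) -(word_sum_cst K); apply: ler_word_sum => l _.
exact: ler0n.
Qed.

Lemma sum_standard_number_le (s : F) : 0 < s ->
  N`!%:R * \sum_(nu : intpart n | (size nu <= K)%N) (standard_number nu)%:R <=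
  n`!%:R * (vdm_moment F K N / s + s * K%:R ^+ N).
Proof.
move=> s0; rewrite mulr_sumr (eq_bigr _ standard_number_vdm) -mulr_sumr.
rewrite ler_wpM2l ?ler0n //.
pose g (l : {ffun 'I_K -> nat}) : F := vdm F l ^+ 2 / s + s.
have g0 l : 0 <= g l by rewrite addr_ge0 ?divr_ge0 ?sqr_ge0 // ltW.
have vdm_le l : vdm F l <= g l.
  have [vs|/ltW sv] := leP (vdm F l) s.
    by rewrite /g ler_wpDl // divr_ge0 ?sqr_ge0 // ltW.
  rewrite /g ler_wpDr ?(ltW s0) // ler_pdivlMr // expr2 ler_wpM2l //.
  exact: le_trans (ltW s0) sv.
apply: (@le_trans _ _ (\sum_(nu : intpart n | (size nu <= K)%N) mass nu * g (shape nu))).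
  by apply: ler_sum => nu _; rewrite ler_wpM2l ?mass_ge0.
have -> : vdm_moment F K N / s + s * K%:R ^+ N = word_sum N g.
  rewrite /g word_sumD word_sum_cst mulrC [s * _]mulrC; congr (_ + _).
  by rewrite -word_sumZ; apply: eq_word_sum => l _; rewrite mulrC.
have -> : \sum_(nu : intpart n | (size nu <= K)%N) mass nu * g (shape nu) =
    word_sum N (fun l => g l * \sum_(nu : intpart n | (size nu <= K)%N) (l == shape nu)%:R).
  under [in RHS]eq_word_sum => l _ do rewrite mulr_sumr.
  rewrite word_sum_sum; apply: eq_bigr => nu _; rewrite mulrC -word_sumZ.
  by apply: eq_word_sum => l _; case: eqP => [->|]; rewrite ?mulr0.
(* Distinct partitions have distinct staggered shapes, so each content is met at most once. *)
apply: ler_word_sum => l _; rewrite ler_piMr //.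
case: (pickP (fun nu : intpart n => (size nu <= K)%N && (l == shape nu))) =>
  [nu0 /andP[nu0K /eqP l_nu0]|none].
  rewrite (bigD1 nu0) //= l_nu0 eqxx big1 ?addr0 // => nu /andP[nuK nu_nu0].
  case: eqP => // /(stagger_intpart_inj nu0K nuK) e.
  by rewrite e eqxx in nu_nu0.
rewrite big1 ?ler01 // => nu nuK; have := none nu; rewrite nuK /=.
by case: eqP.
Qed.

End SumOfDegrees.

(** * Rectangular partitions *)

Section Rectangle.
Variable k : nat.
Hypothesis k_gt0 : (0 < k)%N.

(** Squaring pairs the factor kw + a with kw + k - a; their product is k^2 w(w+1) + a(k-a). The last
    factor k(w+1) is kept apart. *)
Lemma factorial_block_le w :
  ((k * w)`! ^ 2 * (k * w.+1) ^ 2 * (k ^ 2 * (w * w.+1)) ^ k.-1 <= (k * w.+1)`! ^ 2)%N.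
Proof.
have fact_add m : ((k * w + m)`! = (k * w)`! * \prod_(j < m) (k * w + j.+1))%N.
  elim: m => [|m IHm]; first by rewrite addn0 big_ord0 muln1.
  by rewrite addnS factS IHm big_ord_recr /= -addnS mulnC mulnA.
have -> : ((k * w.+1)`! = (k * w)`! * (\prod_(j < k.-1) (k * w + j.+1)) * (k * w.+1))%N.
  rewrite mulnSr fact_add; have [m ->] : exists m, k = m.+1 by exists k.-1; rewrite prednK.
  by rewrite big_ord_recr /= mulnA.
set B := (k * w.+1)%N; set X := (k ^ 2 * _)%N.
rewrite 2!expnMn mulnAC leq_mul2r; apply/orP; right.
rewrite leq_mul2l {B}/X; apply/orP; right.
have -> : ((\prod_(j < k.-1) (k * w + j.+1)) ^ 2 =
    \prod_(j < k.-1) ((k * w + j.+1) * (k * w + (k.-1 - j))))%N.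
  rewrite -mulnn big_split /=; congr (_ * _)%N.
  rewrite (reindex_inj rev_ord_inj) /=; apply: eq_bigr => j _.
  by rewrite subnSK.
rewrite -{1}(card_ord k.-1) -prod_nat_const; apply: leq_prod => j _.
have jk : (j.+1 < k)%N by have := ltn_ord j; lia.
nia.
Qed.

(** A squared, Stirling-free form of the order k^(kw) w^(-(k-1)/2) of the central multinomial
    coefficient. The powers of w telescope in the induction, and k^(2k) pays for w = 1. *)
Lemma multinomial_lower w : (0 < w)%N ->
  (w`! ^ (2 * k) * k ^ (2 * (k * w)) <= (k * w)`! ^ 2 * w ^ k.-1 * k ^ (2 * k))%N.
Proof.
elim: w => // w IHw _; case: (posnP w) => [->|w_gt0].
  by rewrite factS fact0 !muln1 !exp1n mul1n muln1 leq_pmull // expn_gt0 fact_gt0.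
have {}IHw := IHw w_gt0.
apply: leq_trans (_ : (k * w)`! ^ 2 * (k * w.+1) ^ 2 * (k ^ 2 * (w * w.+1)) ^ k.-1 *
    w.+1 ^ k.-1 * k ^ (2 * k) <= _)%N; last first.
  by rewrite !leq_mul2r factorial_block_le !orbT.
apply: leq_trans (_ : (w`! ^ (2 * k) * k ^ (2 * (k * w))) * (k ^ (2 * k) * w.+1 ^ (2 * k)) <= _)%N.
  rewrite factS expnMn mulnSr mulnDr expnD.
  by apply: eq_leq; ring.
have -> : ((k * w)`! ^ 2 * (k * w.+1) ^ 2 * (k ^ 2 * (w * w.+1)) ^ k.-1 *
    w.+1 ^ k.-1 * k ^ (2 * k) =
   ((k * w)`! ^ 2 * w ^ k.-1 * k ^ (2 * k)) * (k ^ (2 * k) * w.+1 ^ (2 * k)))%N.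
  have e x : (x ^ (2 * k) = x ^ 2 * (x ^ 2) ^ k.-1)%N by rewrite -expnS -expnM prednK.
  rewrite !e (expnMn k) (expnMn (k ^ 2)) (expnMn w) (expnAC w.+1).
  by move: ((k ^ 2) ^ k.-1)%N (w ^ k.-1)%N (w.+1 ^ k.-1)%N (k * w)`! => x y z t; ring.
by rewrite leq_mul2r IHw orbT.
Qed.

Lemma factorial_shift_le w d : (d <= k)%N -> ((w + d)`! <= w`! * (w + k) ^ d)%N.
Proof.
elim: d => [|d IHd] dk; first by rewrite addn0 muln1.
rewrite addnS factS expnS mulnCA leq_mul ?(IHd (ltnW dk)) //; lia.
Qed.

(** The determinant is a positive integer, because the number of tableaux is positive, and hence is
    at least 1; this is why the degree formula is taken over [int]. *)
Lemma rect_standard_number w (hw : (0 < w)%N) :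
  ((k * w)`! <= standard_number (rect_intpart k hw) * (w`! ^ k * (w + k) ^ 'C(k, 2)))%N.
Proof.
set p := rect_intpart k hw; set N := standard_number p.
have size_p : (size p <= k)%N by rewrite /= size_nseq.
have vdm_eq := ballot_number_vdm int (decreasing_intpart k p) (sum_intpart_rows size_p).
rewrite -(standard_number_rows k_gt0) // -/N in vdm_eq.
have fact_prod : \prod_i ((stagger k (nth 0%N p) i)`!)%:R =
    (\prod_i (stagger k (nth 0%N p) i)`!)%N%:R :> int.
  by rewrite natr_prod.
rewrite fact_prod in vdm_eq; apply: (@leq_trans (N * \prod_i (stagger k (nth 0%N p) i)`!)).
  have N_gt0 : (0 < N)%N.
    by rewrite /N (standard_number_rows k_gt0) // ballot_number_gt0
      ?decreasing_intpart ?sum_intpart_rows.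
  have prod_gt0 : (0 < \prod_i (stagger k (nth 0%N p) i)`!)%N.
    by rewrite prodn_gt0 // => i; apply: fact_gt0.
  rewrite -(ler_nat int) natrM vdm_eq ler_peMr ?ler0n //.
  have : 0 < (k * w)`!%:R * vdm int (stagger k (nth 0%N p)).
    by rewrite -vdm_eq -natrM ltr0n muln_gt0 N_gt0.
  by rewrite pmulr_rgt0 ?ltr0n ?fact_gt0 // gtz0_ge1.
rewrite leq_mul2l; apply/orP; right.
apply: (@leq_trans (\prod_(i < k) (w`! * (w + k) ^ (k.-1 - i)))%N).
  apply: leq_prod => i _; rewrite ffunE /= nth_nseq ltn_ord.
  by apply: factorial_shift_le; lia.
rewrite big_split /= prod_nat_const card_ord leq_mul2l; apply/orP; right.
rewrite -expn_sum leq_pexp2l ?addn_gt0 ?hw //.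
rewrite -bin2_sum big_mkord [X in (_ <= X)%N](reindex_inj rev_ord_inj) /=.
by apply: leq_sum => i _; lia.
Qed.

Lemma rect_degree_lower w (hw : (0 < w)%N) :
  (k ^ (2 * (k * w)) <= standard_number (rect_intpart k hw) ^ 2 * (k * w) ^ (k ^ 2).-1
     * (k.+1 ^ (k * k.-1) * k ^ (2 * k)))%N.
Proof.
set N := standard_number _; have wk_gt0 : (0 < w`! ^ (2 * k))%N by rewrite expn_gt0 fact_gt0.
rewrite -(leq_pmul2l wk_gt0); apply: leq_trans (multinomial_lower hw) _.
have fact_le : ((k * w)`! ^ 2 <= N ^ 2 * w`! ^ (2 * k) * (w + k) ^ (k * k.-1))%N.
  have <- : (2 * 'C(k, 2) = k * k.-1)%N by rewrite -mul_bin_diag bin1.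
  rewrite ![(2 * _)%N]mulnC !expnM -mulnA -!expnMn leq_exp2r //.
  exact: rect_standard_number.
apply: (@leq_trans (N ^ 2 * w`! ^ (2 * k) * (w * k.+1) ^ (k * k.-1) * w ^ k.-1 * k ^ (2 * k))%N).
  rewrite !leq_mul2r; apply/orP; right; apply/orP; right.
  apply: leq_trans fact_le _; rewrite leq_mul2l; apply/orP; right.
  case: (k * k.-1)%N => // m; rewrite leq_exp2r // mulnS leq_add2l.
  by rewrite leq_pmull.
(* The exponent k(k-1) comes from the staggered factorials, k - 1 from the multinomial
   coefficient. *)
have -> : ((k ^ 2).-1 = k * k.-1 + k.-1)%N.
  by rewrite -[k in RHS](prednK k_gt0) /= -mulnn -{1 2}(prednK k_gt0); lia.
have w_kw : (w <= k * w)%N by rewrite leq_pmull.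
rewrite expnMn [X in (_ <= _ * (_ * X * _))%N]expnD.
apply: (@leq_trans (w`! ^ (2 * k) * (N ^ 2 * (w ^ (k * k.-1) * w ^ k.-1) *
  (k.+1 ^ (k * k.-1) * k ^ (2 * k))))%N); first by apply: eq_leq; ring.
rewrite leq_mul2l leq_mul2r leq_mul2l; do 3!(apply/orP; right).
rewrite -!expnD; case: (_ + _)%N => // m.
by rewrite leq_exp2r.
Qed.

End Rectangle.

(** * Comparison of degrees *)

Section KeyInequality.
Variables (F : realFieldType) (k : nat).
Hypothesis k_gt0 : (0 < k)%N.
Local Notation K := (k ^ 2)%N.
Local Notation P := 'C(k ^ 2, 2).

(** The factor (P+1)^P comes from C(n+P, P) <= (n+P)^P <= (n(P+1))^P; the last summand is the
    surplus of K^(n+P) over K^n. *)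
Definition degree_sum_cst : F := (P.+1 ^ P)%:R * vdm_moment F K P + K%:R ^+ P.
Definition rect_cst : F := (k.+1 ^ (k * k.-1) * k ^ (2 * k))%:R.

Lemma vdm_moment_ge0 N : 0 <= vdm_moment F K N.
Proof.
rewrite -(mulr0 (K%:R ^+ N)) -(word_sum_cst K); apply: ler_word_sum => l _.
exact: sqr_ge0.
Qed.

Lemma bin_le_expn n m : ('C(n, m) <= n ^ m)%N.
Proof.
apply: (@leq_trans (n ^_ m)); first by rewrite -bin_ffact leq_pmulr ?fact_gt0.
elim: m => // m IHm; rewrite ffactnSr expnSr leq_mul // leq_subr //.
Qed.

Lemma fact_expn_le n m : (n`! * n ^ m <= (n + m)`!)%N.
Proof.
elim: m => [|m IHm]; first by rewrite muln1 addn0.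
rewrite expnSr mulnA addnS factS mulnC leq_mul //.
by rewrite leqW ?leq_addr.
Qed.

Lemma sum_standard_number_asymp n (s : F) : (0 < n)%N -> 0 < s -> s ^+ 2 = (n ^ P)%:R ->
  s * \sum_(nu : intpart n | (size nu <= K)%N) (standard_number nu)%:R
    <= K%:R ^+ n * degree_sum_cst.
Proof.
move=> n_gt0 s_gt0 s2; set S := \sum_(nu | _) _.
have K_gt0 : (0 < K)%N by rewrite expn_gt0 k_gt0.
have S_ge0 : 0 <= S by apply: sumr_ge0 => nu _; apply: ler0n.
have nP_gt0 : 0 < (n ^ P)%:R :> F by rewrite ltr0n expn_gt0 n_gt0.
have fact_n_gt0 : 0 < n`!%:R :> F by rewrite ltr0n fact_gt0.
have le1 : (n ^ P)%:R * S <= vdm_moment F K (n + P) / s + s * K%:R ^+ (n + P).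
  rewrite -(ler_pM2l fact_n_gt0); apply: le_trans (sum_standard_number_le n K_gt0 s_gt0).
  by rewrite mulrA ler_wpM2r // -natrM ler_nat fact_expn_le.
have le2 : vdm_moment F K (n + P) <= K%:R ^+ n * ((n ^ P)%:R * ((P.+1 ^ P)%:R * vdm_moment F K P)).
  rewrite addnC vdm_momentE -mulrA ler_wpM2l ?exprn_ge0 ?ler0n // mulrA.
  rewrite ler_wpM2r ?vdm_moment_ge0 // -natrM ler_nat -bin_sub ?leq_addl // addnK.
  apply: leq_trans (bin_le_expn _ _) _; rewrite -expnMn.
  case: {2 4}P => // m; rewrite leq_exp2r // mulnS addnC leq_add2l leq_pmull //.
have : (n ^ P)%:R * (s * S) <= (n ^ P)%:R * (K%:R ^+ n * degree_sum_cst).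
  rewrite mulrCA; apply: le_trans (_ : s * (vdm_moment F K (n + P) / s + s * K%:R ^+ (n + P)) <= _).
    by rewrite ler_pM2l.
  rewrite mulrDr mulrCA divff ?gt_eqF // mulr1 mulrA -expr2 s2 exprD.
  apply: le_trans (lerD le2 (lexx _)) _; rewrite /degree_sum_cst.
  by rewrite le_eqVlt; apply/orP; left; apply/eqP; ring.
by rewrite ler_pM2l.
Qed.

Lemma kronecker_bound w (hw : (0 < w)%N) (n := (k * w)%N) (la := rect_intpart k hw) (s T : F) :
    0 < s -> s ^+ 2 = (n ^ P)%:R -> 0 <= T ->
    (forall nu, (kronecker_mult la la nu)%:R <= T) ->
  s <= rect_cst * degree_sum_cst * n%:R ^+ K.-1 * T.
Proof.
move=> s_gt0 s2 T_ge0 kappa_le.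
have n_gt0 : (0 < n)%N by rewrite muln_gt0 k_gt0.
set S := \sum_(nu : intpart n | (size nu <= K)%N) (standard_number nu)%:R : F.
have le_S : (standard_number la ^ 2)%:R <= T * S.
  rewrite -mulnn kronecker_degree natr_sum mulr_sumr [X in _ <= X]big_mkcond.
  apply: ler_sum => nu _; case: leqP => size_nu.
    by rewrite natrM ler_wpM2r ?ler0n.
  by rewrite kronecker_mult_eq0 ?mul0n // /= size_nseq mulnn.
have le_sS := sum_standard_number_asymp n_gt0 s_gt0 s2; rewrite -/S in le_sS.
have le_K : K%:R ^+ n <= (standard_number la ^ 2)%:R * n%:R ^+ K.-1 * rect_cst.
  by rewrite -!natrX -!natrM ler_nat -expnM rect_degree_lower.
have Kn_gt0 : 0 < K%:R ^+ n :> F by rewrite exprn_gt0 // ltr0n expn_gt0 k_gt0.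
have cst_ge0 : 0 <= n%:R ^+ K.-1 * rect_cst by rewrite mulr_ge0 ?exprn_ge0 ?ler0n.
rewrite -(ler_pM2l Kn_gt0).
apply: le_trans (_ : (T * S) * (n%:R ^+ K.-1 * rect_cst) * s <= _).
  rewrite ler_pM2r //; apply: le_trans le_K _; rewrite -mulrA.
  by rewrite ler_wpM2r.
apply: le_trans (_ : (T * (n%:R ^+ K.-1 * rect_cst)) * (K%:R ^+ n * degree_sum_cst) <= _).
  have -> : T * S * (n%:R ^+ K.-1 * rect_cst) * s = T * (n%:R ^+ K.-1 * rect_cst) * (s * S) by ring.
  by rewrite ler_wpM2l // mulr_ge0.
by rewrite le_eqVlt; apply/orP; left; apply/eqP; ring.
Qed.

End KeyInequality.

(** Otherwise the claimed bound would exceed every multiplicity, and [kronecker_bound] with T equal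
    to it would give n^eps <= [C], which fails for large w. *)
Theorem lemma4p2 (R : realType) (k : nat) (hk : (1 <= k)%N)
    (eps : R) (heps : 0 < eps) :
  exists W : nat, forall (w : nat) (hw : (0 < w)%N), (W <= w)%N ->
    exists nu : intpart (k * w)%N,
      (k * w)%N%:R `^ ((k%:R ^+ 2 - 4) * (k%:R ^+ 2 - 1) / 4 - eps)
        <= (kronecker_mult (rect_intpart k hw) (rect_intpart k hw) nu)%:R :> R.
Proof.
pose C : R := rect_cst R k * degree_sum_cst R k.
(* Chosen so that w^eps, and a fortiori n^eps, exceeds [C]. *)
exists (Num.truncn ((`|C| + 1) `^ eps^-1)).+1 => w hw lt_Ww.
set n := (k * w)%N; set T := n%:R `^ _; set la := rect_intpart k hw.
case: (boolP [exists nu, T <= (kronecker_mult la la nu)%:R]) => [/existsP //|].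
rewrite negb_exists => /forallP lt_T; exfalso.
pose P := 'C(k ^ 2, 2).
have n_gt0 : 0 < n%:R :> R by rewrite ltr0n muln_gt0 hw hk.
have nz (r : R) : (r == 0) ==> (n%:R != 0 :> R) by rewrite (gt_eqF n_gt0) implybT.
have s2 : (n%:R `^ (P%:R / 2)) ^+ 2 = (n ^ P)%:R :> R.
  rewrite -powR_mulrn ?powR_ge0 // -powRrM mulfVK ?pnatr_eq0 //.
  by rewrite powR_mulrn ?natrX // ltW.
have kappa_le nu : (kronecker_mult la la nu)%:R <= T.
  by rewrite ltW // ltNge lt_T.
have := kronecker_bound hk (powR_gt0 _ n_gt0) s2 (powR_ge0 _ _) kappa_le.
rewrite -/C -powR_mulrn ?(ltW n_gt0) // -mulrA -(powRD (nz _)).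
have -> : P%:R / 2 = (((k ^ 2).-1)%:R + ((k%:R ^+ 2 - 4) * (k%:R ^+ 2 - 1) / 4 - eps)) + eps :> R.
  have P2 : P%:R * 2 = (k%:R ^+ 2) * (k%:R ^+ 2 - 1) :> R.
    rewrite -natrM mulnC -mul_bin_diag bin1 natrM natrX; congr (_ * _).
    by rewrite -subn1 natrB ?natrX // expn_gt0 hk.
  rewrite -subn1 natrB ?natrX ?expn_gt0 ?hk //.
  by rewrite -[P%:R](mulfK (_ : 2 != 0)) ?pnatr_eq0 // P2; field.
rewrite -/n [X in X <= _](powRD (nz _)) [X in X <= _]mulrC ler_pM2r ?powR_gt0 //.
apply/negP; rewrite -ltNge.
have le_wn : w%:R `^ eps <= n%:R `^ eps.
  by rewrite ge0_ler_powR ?nnegrE ?ler0n ?ler_nat ?leq_pmull // ltW.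
apply: lt_le_trans le_wn; apply: (@lt_trans _ _ (`|C| + 1)).
  by rewrite (le_lt_trans (ler_norm C)) // ltrDl.
have -> : `|C| + 1 = ((`|C| + 1) `^ eps^-1) `^ eps.
  by rewrite -powRrM mulVf ?lt0r_neq0 // powRr1 // addr_ge0.
apply: gt0_ltr_powR; rewrite ?nnegrE ?powR_ge0 ?ler0n //.
apply: lt_le_trans (truncnS_gt ((`|C| + 1) `^ eps^-1)) _.
by rewrite ler_nat.
Qed.
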